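(* Let $S$ be a Seidel matrix of order $n\geqslant277$ with $\lambda_{\min}(S)=-5$. If $\alpha([S])\geqslant49$, then $\operatorname{rk}(S+5\mathbf{I})\geqslant\frac{2n}{3}+1$.
   Context: All graphs are finite, simple, undirected. A Seidel matrix of order $n$ is a real symmetric $n\times n$ matrix with zero diagonal and off-diagonal entries in $\{\pm1\}$; its graph $G(S)$ has vertex set $\{1,\dots,n\}$ with $i\sim j$ iff $S_{ij}=-1$. The switching graph $\mathcal{Sw}(S)$ of $S$ (for $n\geqslant2$) is the graph $G(S')$ of the Seidel matrix $S'=\begin{pmatrix}S&-S+\mathbf{I}\\-S+\mathbf{I}&S\end{pmatrix}$ of order $2n$. The independence number of the switching class of $S$ is $\alpha([S]):=\alpha(\mathcal{Sw}(S))$, the independence number of $\mathcal{Sw}(S)$. $\lambda_{\min}$ is the smallest eigenvalue, $\operatorname{rk}$ the rank. *)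

(* Defs.v *)
From mathcomp Require Import all_boot all_order all_algebra.
From mathcomp Require Import reals.

Set Implicit Arguments.
Unset Strict Implicit.
Unset Printing Implicit Defensive.

Import Order.TTheory GRing.Theory Num.Theory.
Local Open Scope ring_scope.

Definition is_seidel (R : realType) (n : nat) (S : 'M[R]_n) : Prop :=
  [/\ S^T = S,
      forall i : 'I_n, S i i = 0
    & forall i j : 'I_n, i != j -> S i j = 1 \/ S i j = -1].

(* For a Seidel matrix the zero diagonal and the symmetry make this relation
   irreflexive and symmetric, i.e. a simple graph on 'I_n. *)
Definition seidel_graph (R : realType) (n : nat) (S : 'M[R]_n) : rel 'I_n :=
  fun i j => S i j == -1.

Definition switching_mx (R : realType) (n : nat) (S : 'M[R]_n) : 'M[R]_(n + n) :=
  block_mx S (- S + 1%:M) (- S + 1%:M) S.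

Definition switching_graph (R : realType) (n : nat) (S : 'M[R]_n) :
    rel 'I_(n + n) :=
  seidel_graph (switching_mx S).

Definition independent (T : finType) (e : rel T) (A : {set T}) : bool :=
  [forall x in A, forall y in A, ~~ e x y].

Definition independence_number (T : finType) (e : rel T) : nat :=
  (\max_(A : {set T} | independent e A) #|A|)%N.

Definition alpha_class (R : realType) (n : nat) (S : 'M[R]_n) : nat :=
  independence_number (switching_graph S).

Definition is_min_eigenvalue (R : realType) (n : nat) (S : 'M[R]_n) (a : R) :
    Prop :=
  eigenvalue S a /\ forall b : R, eigenvalue S b -> a <= b.

(* Main.v *)
Require Import Defs.
From mathcomp Require Import all_boot all_order all_algebra.
From mathcomp Require Import reals boolp ring lra zify.

Import Order.TTheory GRing.Theory Num.Theory.
Local Open Scope ring_scope.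

(* The positive semidefinite matrix H = S + 5I is a Gram matrix.  After
   switching, a maximum independent set of the switching graph becomes a set A
   of t >= 49 indices with pairwise inner product 1.  For x outside A let B_x be
   the set of i in A with H_ix = -1, made at most half of A by switching x, and
   b_x = |B_x|.  Eliminating the A-coordinates leaves the form
     q(z) + W(z)^2 / (t + 4),   W(z) = sum (b_x + 2) z_x,
   where q has diagonal 4 - b_x (so that b_x <= 4) and nonpositive off-diagonal
   entries, and the kernel of H is isomorphic to the kernel of this form.

   If q >= 0, a kernel vector z satisfies q(z) = W(z) = 0.  By Perron-Frobenius
   it is determined by one value on each singular component of q, and W(z) = 0
   removes one more degree of freedom; each such component uses up at least
   three indices, counting those of A that lie in some B_x, whence
   3 nullity <= n - 3.

   Otherwise take a nonnegative vector with q < 0 on a minimal support C.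
   Proper subsets of C that miss two vertices are positive definite, C is
   connected, and some row of q on C has negative sum; a finite search shows
   that this forces |C| <= 6.  A nonzero kernel vector y vanishing on C and its
   neighbours would give q < 0 = W on the span of |y| and the vector on C, so
   the nullity is at most the number of these vertices, which is at most
   6 * 14 = 84 because every vertex has at most 13 neighbours. *)

(** * Quadratic forms with nonpositive off-diagonal coefficients *)

Section WeightedForm.
Variables (R : realFieldType) (V : finType) (d : V -> nat) (k : V -> V -> nat).
Implicit Types u v z : V -> R.

Definition lap z x : R := (d x)%:R * z x - \sum_y (k x y)%:R * z y.
Definition bform u z : R := \sum_x u x * lap z x.
Definition qform z : R := bform z z.

Hypothesis kC : forall x y, k x y = k y x.

Lemma bformC u z : bform u z = bform z u.
Proof.
rewrite /bform /lap.
under eq_bigr do rewrite mulrBr mulr_sumr.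
under [in RHS]eq_bigr do rewrite mulrBr mulr_sumr.
rewrite !big_split /= !sumrN; congr (_ - _).
  by apply: eq_bigr => x _; ring.
by rewrite exchange_big; apply: eq_bigr => x _; apply: eq_bigr => y _; rewrite kC; ring.
Qed.

Lemma bform_comb u v s z :
  bform (fun x => u x + s * v x) z = bform u z + s * bform v z.
Proof. by rewrite /bform mulr_sumr -big_split; apply: eq_bigr => x _ /=; ring. Qed.

Lemma qform_comb u v s :
  qform (fun x => u x + s * v x) = qform u + 2 * s * bform u v + s ^+ 2 * qform v.
Proof.
set w := fun x => _; rewrite /qform bform_comb (bformC u w) (bformC v w) !bform_comb.
by rewrite (bformC v u); ring.
Qed.

Lemma eq_lap u z x : u =1 z -> lap u x = lap z x.
Proof.
by move=> e; rewrite /lap e; congr (_ - _); apply: eq_bigr => y _; rewrite e.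
Qed.

Lemma eq_qform u z : u =1 z -> qform u = qform z.
Proof. by move=> e; apply: eq_bigr => x _; rewrite e (eq_lap _ _ _ e). Qed.

Lemma bform_disjoint u v :
  (forall x y, u x != 0 -> v y != 0 -> x != y /\ k x y = 0%N) -> bform u v = 0.
Proof.
move=> h; apply: big1 => x _; have [->|ux] := eqVneq (u x) 0; first by rewrite mul0r.
have vx : v x = 0 by apply/eqP/negPn/negP => vx; case: (h x x ux vx); rewrite eqxx.
rewrite /lap vx mulr0 big1 ?subrr ?mulr0 // => y _.
have [->|vy] := eqVneq (v y) 0; first by rewrite mulr0.
by have [_ ->] := h x y ux vy; rewrite mul0r.
Qed.

(** Squares are unchanged, and the products [z x * z y] carry the coefficient [- k x y <= 0], so a
    negative vector can be replaced by a nonnegative one. *)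
Lemma qform_abs_le z : qform (fun x => `|z x|) <= qform z.
Proof.
apply: ler_sum => x _; rewrite /lap !mulrBr.
have -> : `|z x| * ((d x)%:R * `|z x|) = z x * ((d x)%:R * z x).
  by rewrite mulrCA -expr2 real_normK ?num_real // expr2 mulrCA.
rewrite lerB // !mulr_sumr; apply: ler_sum => y _.
apply: le_trans (ler_norm _) _.
by rewrite !normrM normr_nat.
Qed.

(** Diagonal dominance: bound [2 * z x * z y] by [z x ^+ 2 + z y ^+ 2], after which the symmetry of
    [k] collects the row sums. *)
Lemma qform_ge0_of_dominant (C : {set V}) z :
    (forall x, x \in C -> (\sum_(y in C) k x y <= d x)%N) ->
    (forall x, x \notin C -> z x = 0) -> 0 <= qform z.
Proof.
move=> dom sz.
have inC F : (forall x, z x = 0 -> F x = 0) -> \sum_x F x = \sum_(x in C) F x :> R.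
  by move=> F0; rewrite [RHS]big_mkcond; apply: eq_bigr => x _; case: ifPn => // /sz/F0.
have -> : qform z = \sum_(x in C) (d x)%:R * z x ^+ 2 -
   \sum_(x in C) \sum_(y in C) (k x y)%:R * (z x * z y).
  rewrite /qform /bform /lap inC; last by move=> x ->; rewrite mul0r.
  rewrite -sumrB; apply: eq_bigr => x _; rewrite inC; last by move=> y ->; rewrite mulr0.
  by rewrite mulrBr mulr_sumr; congr (_ - _); [ring|apply: eq_bigr => y _; ring].
rewrite subr_ge0.
have := @ler_sum R _ (enum C) xpredT
  (fun x => \sum_(y in C) (k x y)%:R * (z x * z y))
  (fun x => \sum_(y in C) (k x y)%:R * ((z x ^+ 2 + z y ^+ 2) / 2)).
rewrite !big_enum => le1; apply: le_trans (le1 _) _.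
  move=> x _; apply: ler_sum => y _; apply: ler_wpM2l => //.
  by rewrite ler_pdivlMr //; have := sqr_ge0 (z x - z y); lra.
have -> : \sum_(x in C) \sum_(y in C) (k x y)%:R * ((z x ^+ 2 + z y ^+ 2) / 2)
        = \sum_(x in C) \sum_(y in C) (k x y)%:R * z x ^+ 2.
  transitivity (\sum_(x in C) \sum_(y in C) (k x y)%:R * z x ^+ 2 / 2 +
                \sum_(x in C) \sum_(y in C) (k x y)%:R * z y ^+ 2 / 2).
    rewrite -big_split; apply: eq_bigr => x _; rewrite -big_split.
    by apply: eq_bigr => y _ /=; field.
  rewrite [X in _ + X]exchange_big -big_split; apply: eq_bigr => x _; rewrite -big_split.
  by apply: eq_bigr => y _ /=; rewrite kC; field.
apply: ler_sum => x xC; rewrite -mulr_suml ler_wpM2r ?sqr_ge0 //.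
by rewrite -natr_sum ler_nat dom.
Qed.

(** A zero of a nonnegative form is a minimum, so the gradient vanishes there. *)
Lemma lap_eq0_of_ge0 z : (forall u, 0 <= qform u) -> qform z = 0 -> forall x, lap z x = 0.
Proof.
move=> q0 qz x.
have bx u : bform u z = 0.
  set b := bform u z; set c := qform u.
  have c0 : 0 <= c := q0 u.
  (* The minimising coefficient would be [- b / c]; the denominator [c + 1] avoids a division by
     zero and still gives a negative value unless [b = 0]. *)
  have := q0 (fun x => z x + (- b / (c + 1)) * u x).
  rewrite qform_comb qz bformC -/b -/c => h.
  have c1 : 0 < c + 1 by lra.
  have : 0 <= (c + 1) ^+ 2 * (0 + 2 * (- b / (c + 1)) * b + (- b / (c + 1)) ^+ 2 * c).
    by rewrite mulr_ge0 ?sqr_ge0.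
  have -> : (c + 1) ^+ 2 * (0 + 2 * (- b / (c + 1)) * b + (- b / (c + 1)) ^+ 2 * c)
    = - (b ^+ 2 * (c + 2)) by field; lra.
  rewrite oppr_ge0 pmulr_lle0 ?ltr_wpDl // => bb.
  by apply/eqP; rewrite -sqrf_eq0 eq_le bb sqr_ge0.
have := bx (fun y => (y == x)%:R).
rewrite /bform (bigD1 x) //= eqxx mul1r big1 ?addr0 // => y /negbTE ->.
by rewrite mul0r.
Qed.

(** The Perron-Frobenius step: where [z] vanishes, the equation says that a sum of nonnegative terms
    is zero. *)
Lemma lap0_neighbour z x y : (forall x, 0 <= z x) -> lap z x = 0 ->
  z x = 0 -> (0 < k x y)%N -> z y = 0.
Proof.
move=> z0; rewrite /lap => h zx kxy; move: h; rewrite zx mulr0 sub0r => /eqP.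
rewrite oppr_eq0 psumr_eq0; last by move=> *; rewrite mulr_ge0.
move=> /allP /(_ y (mem_index_enum y)) /=; rewrite mulf_eq0 pnatr_eq0.
by case/orP => /eqP // k0; rewrite k0 in kxy.
Qed.

Lemma lap0_connected z x y : (forall x, 0 <= z x) -> (forall x, lap z x = 0) ->
  connect (fun x y => 0 < k x y)%N x y -> z x = 0 -> z y = 0.
Proof.
move=> z0 l0 /connectP[p]; elim: p x => [|w p ih] x /=; first by move=> _ ->.
by case/andP => kxw pth ey zx; apply: ih pth ey _; exact: lap0_neighbour kxw.
Qed.

End WeightedForm.

(** * Minimal supports of negative vectors *)

Section MinimalNegativeSupport.
Variables (R : realFieldType) (V : finType) (d : V -> nat) (k : V -> V -> nat).
Implicit Types (z : V -> R) (C D : {set V}).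
Local Notation qform := (qform R V d k).

Definition negative_on C : Prop :=
  exists z, [/\ forall x, 0 <= z x, forall x, x \notin C -> z x = 0 & qform z < 0].

Definition minimal_negative C : Prop :=
  negative_on C /\ forall D, (#|D| < #|C|)%N -> ~ negative_on D.

Lemma minimal_negative_exists z : qform z < 0 -> exists C, minimal_negative C.
Proof.
move=> qz; pose P C := `[< negative_on C >].
have PT : P setT.
  apply/asboolP; exists (fun x => `|z x|); split=> // [x|]; first by rewrite inE.
  exact: le_lt_trans (qform_abs_le _ _ _ _ _) qz.
case: (arg_minnP (fun C : {set V} => #|C|) PT) => C /asboolP nC minC.
exists C; split=> // D ltDC nD; suff /minC : P D by rewrite leqNgt ltDC.
exact/asboolP.
Qed.

Hypothesis kC : forall x y, k x y = k y x.
Variables (C : {set V}) (minC : minimal_negative C).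

Lemma qform_ge0_of_card_lt D z : (#|D| < #|C|)%N -> (forall x, 0 <= z x) ->
  (forall x, x \notin D -> z x = 0) -> 0 <= qform z.
Proof. by move=> ltD z0 sD; case: ltP => // qz; case: (minC.2 D ltD); exists z. Qed.

(** With no edge between [D] and [C :\: D] the form would split as the sum of its values at the two
    restrictions of [z], both nonnegative by minimality. *)
Lemma minimal_negative_connected D : D \subset C -> D != set0 -> D != C ->
  exists x y, [/\ x \in D, y \in C :\: D & (0 < k x y)%N].
Proof.
move=> sDC D0 DC; have [[z [z0 zC qz]] _] := minC.
case: (pselect (exists x y, [/\ x \in D, y \in C :\: D & (0 < k x y)%N])) => // noedge.
pose u x := if x \in D then z x else 0; pose v x := if x \in D then 0 else z x.
have pDC : D \proper C by rewrite properEneq DC.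
have qu : 0 <= qform u.
  apply: (qform_ge0_of_card_lt D); first exact: proper_card.
    by move=> x; rewrite /u; case: ifP.
  by move=> x /negbTE; rewrite /u => ->.
have qv : 0 <= qform v.
  apply: (qform_ge0_of_card_lt (C :\: D)).
  - have := cardsID D C; rewrite (setIidPr sDC) => <-.
    by rewrite -[X in (X < _)%N]add0n ltn_add2r card_gt0.
  - by move=> x; rewrite /v; case: ifP.
  - by move=> x; rewrite inE /v; case: ifP => //= _ /zC.
have uv : bform R V d k u v = 0.
  apply: bform_disjoint => x y; rewrite /u /v.
  case: ifP => xD; rewrite ?eqxx // => _; case: ifP => yD; rewrite ?eqxx // => zy.
  split; first by apply: contraFneq yD => <-.
  apply/eqP; rewrite -leqn0 leqNgt; apply/negP => kxy; apply: noedge.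
  exists x, y; split=> //; rewrite inE yD /=.
  by apply: contraNT zy => /zC ->.
have := qz; rewrite (eq_qform _ _ _ _ _ (fun x => u x + 1 * v x)).
  by rewrite qform_comb // uv; lra.
by move=> x; rewrite /u /v; case: ifP => _; ring.
Qed.

(** If [qform z = 0], connectivity gives a vertex [y] of [C] adjacent to the support of [z]; a small
    positive value at [y] makes the form negative on [y |: D]. Two vertices must be missing so that
    this set is still smaller than [C]. *)
Lemma minimal_negative_posdef D z : D \subset C -> (#|D|.+1 < #|C|)%N ->
  (forall x, 0 <= z x) -> (forall x, x \notin D -> z x = 0) ->
  (exists x, z x != 0) -> 0 < qform z.
Proof.
move=> sDC ltD z0 zD [x0 zx0].
have q0 : 0 <= qform z by apply: (qform_ge0_of_card_lt D) => //; exact: ltnW.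
rewrite lt_neqAle q0 andbT; apply/eqP => qz.
pose S := [set x | z x != 0].
have sSD : S \subset D.
  by apply/subsetP => x; rewrite inE; apply: contraNT => /zD ->.
have S0 : S != set0 by apply/set0Pn; exists x0; rewrite inE.
have sSC := subset_trans sSD sDC.
have cSD := subset_leq_card sSD.
have SC : S != C.
  by apply: contraTneq ltD => <-; rewrite -leqNgt (leq_trans cSD).
have [x [y [xS]]] := minimal_negative_connected _ sSC S0 SC.
rewrite !inE negbK => /andP[/eqP zy yC] kxy.
pose e w : R := (w == y)%:R.
pose s := \sum_w (k y w)%:R * z w.
have zx : 0 < z x by rewrite lt_neqAle z0 eq_sym andbT; move: xS; rewrite inE.
have s0 : 0 < s.
  rewrite /s (bigD1 x) //= ltr_pwDl //; first by rewrite mulr_gt0 // kC ltr0n.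
  by apply: sumr_ge0 => w _; rewrite mulr_ge0.
have bez : bform R V d k e z = - s.
  rewrite /bform (bigD1 y) //= big1; last by move=> w /negbTE wy; rewrite /e wy mul0r.
  by rewrite /e eqxx mul1r addr0 /lap zy mulr0 sub0r.
(* Chosen so that [t * c <= s]: the linear term [- 2 * t * s] then outweighs [t ^+ 2 * c]. *)
pose c := qform e; pose t := s / (`|c| + 1).
have c1 : 0 < `|c| + 1 by rewrite ltr_wpDl.
have t0 : 0 < t by rewrite divr_gt0.
have : 0 <= qform (fun w => z w + t * e w).
  apply: (qform_ge0_of_card_lt (y |: D)).
  - by apply: leq_ltn_trans ltD; rewrite cardsU1 -add1n leq_add2r leq_b1.
  - by move=> w; rewrite addr_ge0 // mulr_ge0 // ltW.
  - by move=> w; rewrite !inE negb_or /e => /andP[/negbTE -> /zD ->]; rewrite mulr0 addr0.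
rewrite qform_comb // -qz bformC // bez -/c.
have ct : t * c <= s.
  rewrite /t mulrAC ler_pdivrMr // ler_pM2l //.
  by have := ler_norm c; lra.
by have := mulr_gt0 t0 s0; have : t * (t * c) <= t * s; [rewrite ler_pM2l|nra].
Qed.

Lemma minimal_negative_nondominant :
  exists2 v, v \in C & (d v < \sum_(y in C) k v y)%N.
Proof.
have [[z [_ zC qz]] _] := minC.
case: (pselect (exists2 v, v \in C & (d v < \sum_(y in C) k v y)%N)) => // dom.
suff : 0 <= qform z by rewrite leNgt qz.
apply: (qform_ge0_of_dominant _ _ _ _ kC C) => // x xC.
by rewrite leqNgt; apply/negP => ?; apply: dom; exists x.
Qed.

End MinimalNegativeSupport.

(** * Refuting minimal negative supports with at least seven vertices *)

(* [(ws, m)] records a sequence of vertices of the weighted graph: their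
   weights [#|B x|] and the matrix of the multiplicities [k x y]. *)
Definition config := (seq nat * seq (seq nat))%type.

Definition weight (s : config) i := nth 0%N s.1 i.
Definition mult (s : config) i j := nth 0%N (nth [::] s.2 i) j.

Definition extend (s : config) b ks : config :=
  (rcons s.1 b, rcons [seq rcons p.1 p.2 | p <- zip s.2 ks] (rcons ks 0%N)).

(** The diagonal and off-diagonal parts of the form are compared as natural numbers; the positive
    head ensures that the vector is nonzero. *)
Definition nonpositive_at (s : config) (z : seq nat) : bool :=
  let r := iota 0 (size s.1) in
  [&& size z == size s.1, 0 < head 0 z
    & sumn [seq (4 - weight s i) * (nth 0 z i * nth 0 z i) | i <- r]
      <= sumn [seq sumn [seq mult s i j * (nth 0 z i * nth 0 z j) | j <- r] | i <- r]]%N.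

(* Found by computer search: every configuration on five vertices reached by
   [refuted] and passing the first three tests of [forbidden] has one of these
   vectors as a witness that its form is not positive definite. *)
Definition test_vectors : seq (seq nat) :=
 [::
   [:: 1; 1]; [:: 1; 1; 1]; [:: 1; 0; 1]; [:: 2; 1; 1];
   [:: 1; 1; 1; 1]; [:: 2; 1; 1; 1]; [:: 1; 0; 1; 1]; [:: 1; 1; 0; 1];
   [:: 3; 1; 1; 2]; [:: 3; 1; 2; 1]; [:: 3; 2; 1; 1]; [:: 3; 2; 2; 1];
   [:: 3; 1; 1; 1]; [:: 6; 4; 5; 3; 1]; [:: 6; 5; 4; 3; 1]; [:: 3; 1; 2; 3; 1];
   [:: 5; 3; 3; 4; 2]; [:: 3; 2; 1; 3; 1]; [:: 3; 2; 2; 2; 1]; [:: 6; 2; 5; 3; 1];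
   [:: 3; 1; 3; 2; 1]; [:: 5; 3; 4; 3; 2]; [:: 5; 3; 3; 4; 1]; [:: 3; 2; 3; 1; 1];
   [:: 5; 3; 4; 3; 1]; [:: 6; 5; 2; 3; 1]; [:: 2; 2; 1; 0; 1]; [:: 5; 4; 3; 3; 2];
   [:: 3; 3; 1; 2; 1]; [:: 3; 3; 2; 1; 1]; [:: 5; 4; 3; 3; 1]; [:: 3; 1; 2; 2; 1];
   [:: 3; 2; 1; 2; 1]; [:: 3; 1; 2; 1; 1]; [:: 3; 2; 1; 1; 1]]%N.

(** The first three tests detect violations of the hypotheses [b1_pair], [b1_nbrs] and [b2_nbrs] of
    the refutation, the last one a failure of positive definiteness. Conditionals in place of
    conjunctions spare a strict evaluator the second test. *)
Definition forbidden (s : config) : bool :=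
  let r := iota 0 (size s.1) in
  let nb i := [seq j <- r | mult s i j == 1%N] in
  let sep i j := (i != j) && (mult s i j == 0%N) in
  [|| has (fun i => if weight s i == 1%N then has (fun j => weight s j == 1%N) (nb i) else false) r,
      has (fun i => if weight s i == 1%N then
             has (fun j => has (sep j) (nb i)) (nb i) else false) r,
      has (fun i => if weight s i == 2%N then
             has (fun j => has (fun l => if sep j l then has (fun m => sep j m && sep l m) (nb i)
                                         else false) (nb i)) (nb i) else false) r
    | has (nonpositive_at s) [seq z <- test_vectors | size z == size s.1]].

(** Entries stop at 2: diagonal entries are at most 3, so a multiplicity of 3 or more is excluded by
    the vector [[:: 1; 1]]. *)
Fixpoint rows n : seq (seq nat) :=
  if n is n'.+1 then [seq x :: c | x <- iota 0 3, c <- rows n'] else [:: [::]].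

(* The new vertex is a neighbour of the first one until the multiplicities at
   the first one exceed [4 - weight]; from then on any neighbour is allowed. *)
Definition admissible (s : config) (ks : seq nat) : bool :=
  ((0 < sumn ks) && ((sumn (head [::] s.2) <= 4 - weight s 0) ==> (0 < head 0 ks)))%N.

(** Depth-first search through the admissible extensions. Weight 4 is left out because its diagonal
    entry 0 contradicts positive definiteness on one vertex. *)
Fixpoint refuted fuel (s : config) : bool :=
  if fuel is fuel'.+1 then
    all (fun b => all (fun ks => if admissible s ks then
           let s' := extend s b ks in if forbidden s' then true else refuted fuel' s'
         else true) (rows (size s.1))) (iota 1 3)
  else false.

(** The finite search, done by computation. Four extensions lead to five vertices, the largest size
    for which a subset of a seven-element minimal support is known to be positive definite. *)
Lemma refuted_single b : (0 < b <= 3)%N -> refuted 4 ([:: b], [:: [:: 0%N]]).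
Proof.
suff : all (fun b => refuted 4 ([:: b], [:: [:: 0%N]])) (iota 1 3).
  by move=> /allP h /andP[b0 b3]; apply: h; rewrite mem_iota b0.
by vm_cast_no_check (erefl true).
Qed.

Lemma sumn_iota_nth (T : Type) (x0 : T) (l : seq T) (F : nat -> nat) (G : T -> nat) :
  (forall i, (i < size l)%N -> F i = G (nth x0 l i)) ->
  sumn [seq F i | i <- iota 0 (size l)] = (\sum_(x <- l) G x)%N.
Proof.
move=> FG; rewrite sumnE big_map (big_nth x0) /index_iota subn0.
by apply: eq_big_seq => i; rewrite mem_iota => /FG.
Qed.

Lemma mem_rows ks : all (fun x => x < 3)%N ks -> ks \in rows (size ks).
Proof.
elim: ks => [//|x ks ih] /andP[x3 /ih ksin].
by rewrite [rows _]/(allpairs cons (iota 0 3) _) allpairs_f // mem_iota.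
Qed.

Lemma refutedS fuel s b ks : refuted fuel.+1 s -> (0 < b <= 3)%N ->
  ks \in rows (size s.1) -> admissible s ks -> forbidden (extend s b ks) = false ->
  refuted fuel (extend s b ks).
Proof.
move=> /allP h b3 ksr adm fb; have := h b; rewrite mem_iota => /(_ b3) /allP /(_ ks ksr).
by rewrite adm /= fb.
Qed.

(** * Configurations realised inside a minimal support *)

Section Refutation.
Variables (R : realFieldType) (V : finType) (b : V -> nat) (k : V -> V -> nat).
Local Notation d := (fun x => 4 - b x)%N.
Hypothesis kC : forall x y, k x y = k y x.
Hypothesis kxx : forall x, k x x = 0%N.
Hypothesis b0 : forall x, (0 < b x)%N.
Hypothesis b1_pair : forall x y, b x = 1%N -> b y = 1%N -> k x y <> 1%N.
Hypothesis b1_nbrs : forall v x y, b v = 1%N -> k v x = 1%N -> k v y = 1%N ->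
  x != y -> k x y <> 0%N.
Hypothesis b2_nbrs : forall v x y w, b v = 2%N -> k v x = 1%N -> k v y = 1%N ->
  k v w = 1%N -> x != y -> x != w -> y != w ->
  k x y = 0%N -> k x w = 0%N -> k y w <> 0%N.
Variable C : {set V}.
Hypothesis minC : minimal_negative R V d k C.
Hypothesis cardC : (7 <= #|C|)%N.

Definition config_of (l : seq V) : config := (map b l, [seq map (k x) l | x <- l]).

Lemma extend_config_of l y :
  extend (config_of l) (b y) (map (k y) l) = config_of (rcons l y).
Proof.
rewrite /extend /config_of /= !map_rcons kxx; congr (_, rcons _ _).
rewrite -[map (k y) l]/(map (k y) l) zip_map -map_comp.
by apply: eq_map => x /=; rewrite map_rcons kC.
Qed.

Lemma weight_config_of x0 l i : (i < size l)%N ->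
  weight (config_of l) i = b (nth x0 l i).
Proof. by move=> il; rewrite /weight (nth_map x0). Qed.

Lemma mult_config_of x0 l i j : (i < size l)%N -> (j < size l)%N ->
  mult (config_of l) i j = k (nth x0 l i) (nth x0 l j).
Proof. by move=> il jl; rewrite /mult (nth_map x0) // (nth_map x0). Qed.

(** Spread along [l], the entries of [z] form a nonzero nonnegative vector on at most five vertices
    of [C], so [minimal_negative_posdef] applies. *)
Lemma nonpositive_at_config_of l z : uniq l -> {subset l <= C} -> (size l <= 5)%N ->
  nonpositive_at (config_of l) z = false.
Proof.
case: l => [|x0 l'] => [|]; first by case: z => // ???; rewrite /nonpositive_at ltnn andbF.
set l := x0 :: l' => ul lC l5; apply/negP.
have rE : size (config_of l).1 = size l by rewrite size_map.
rewrite /nonpositive_at rE.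
case/and3P => /eqP sz z0 le_z.
pose ze x := nth 0%N z (index x l).
pose f x : R := if x \in l then (ze x)%:R else 0.
have zen i : (i < size l)%N -> nth 0%N z i = ze (nth x0 l i) by move=> il; rewrite /ze index_uniq.
have sumf (F : V -> R) : (forall x, f x = 0 -> F x = 0) -> \sum_x F x = \sum_(x <- l) F x.
  move=> F0; rewrite (big_uniq _ ul) /= [RHS]big_mkcond; apply: eq_bigr => x _.
  by case: ifPn => // /negbTE xl; apply: F0; rewrite /f xl.
have : 0 < qform R V d k f.
  apply: (minimal_negative_posdef _ _ _ _ kC _ minC [set x in l]).
  - by apply/subsetP => x; rewrite inE => /lC.
  - by rewrite cardsE (card_uniqP ul) (leq_trans _ cardC).
  - by move=> x; rewrite /f; case: ifP.
  - by move=> x; rewrite inE /f => /negbTE ->.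
  exists x0; rewrite /f /l mem_head /ze /= eqxx.
  by move: z0; case: (z) => //= a ?; rewrite pnatr_eq0 lt0n.
rewrite /qform /bform /lap sumf; last by move=> x ->; rewrite mul0r.
apply/negP; rewrite -leNgt.
have -> : \sum_(x <- l) f x * ((d x)%:R * f x - \sum_y (k x y)%:R * f y) =
  (\sum_(x <- l) (4 - b x) * (ze x * ze x))%N%:R -
  (\sum_(x <- l) \sum_(y <- l) k x y * (ze x * ze y))%N%:R.
  rewrite !natr_sum -sumrB; apply: eq_big_seq => x xl.
  rewrite sumf; last by move=> y ->; rewrite mulr0.
  rewrite natr_sum mulrBr mulr_sumr /f xl; congr (_ - _).
    by rewrite !natrM; ring.
  by apply: eq_big_seq => y ->; rewrite !natrM; ring.
rewrite subr_le0 ler_nat.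
move: le_z.
rewrite (sumn_iota_nth _ x0 _ _ (fun x => (4 - b x) * (ze x * ze x))%N); last first.
  by move=> i il; rewrite (weight_config_of x0) // zen.
rewrite (sumn_iota_nth _ x0 _ _ (fun x => \sum_(y <- l) k x y * (ze x * ze y))%N) //.
move=> i il; apply: sumn_iota_nth => j jl.
by rewrite (mult_config_of x0) // !zen.
Qed.

Lemma forbidden_config_of l : uniq l -> {subset l <= C} -> (size l <= 5)%N ->
  forbidden (config_of l) = false.
Proof.
case: l => [|x0 l']; first by rewrite /forbidden /=.
set l := x0 :: l' => ul lC l5.
have rE : size (config_of l).1 = size l by rewrite size_map.
have nbP i j : i \in iota 0 (size l) ->
    j \in [seq j <- iota 0 (size l) | mult (config_of l) i j == 1%N] ->
  [/\ (i < size l)%N, (j < size l)%N & k (nth x0 l i) (nth x0 l j) = 1%N].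
  rewrite mem_filter !mem_iota /= !add0n => il /andP[/eqP m jl].
  by split=> //; rewrite -mult_config_of.
have sepP i j : (i < size l)%N -> (j < size l)%N ->
    (i != j) && (mult (config_of l) i j == 0%N) ->
    nth x0 l i != nth x0 l j /\ k (nth x0 l i) (nth x0 l j) = 0%N.
  move=> il jl /andP[ij /eqP]; rewrite (mult_config_of x0) // => ->.
  by rewrite nth_uniq.
apply/negP; rewrite /forbidden rE; case/or4P => /hasP[i].
- move=> ir; case: ifP => // /eqP wi /hasP[j /(nbP _ _ ir)[il jl kij]] /eqP.
  rewrite (weight_config_of x0) // => wj; rewrite (weight_config_of x0) // in wi.
  exact: b1_pair kij.
- move=> ir; case: ifP => // /eqP wi /hasP[j /(nbP _ _ ir)[il jl kij]].
  case/hasP => m /(nbP _ _ ir)[_ ml kim] /(sepP _ _ jl ml)[jm].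
  by rewrite (weight_config_of x0) // in wi; apply: b1_nbrs kij kim jm.
- move=> ir; case: ifP => // /eqP wi /hasP[j /(nbP _ _ ir)[il jl kij]].
  case/hasP => m /(nbP _ _ ir)[_ ml kim]; case: ifP => // /(sepP _ _ jl ml)[jm kjm].
  case/hasP => p /(nbP _ _ ir)[_ pl kip] /andP[/(sepP _ _ jl pl)[jp kjp] /(sepP _ _ ml pl)[mp kmp]].
  rewrite (weight_config_of x0) // in wi.
  exact: (b2_nbrs _ _ _ _ wi kij kim kip jm jp mp kjm kjp kmp).
- by rewrite nonpositive_at_config_of.
Qed.

(** The search cannot close, since [C] always supplies an admissible extension that is not
    forbidden. While the row of [v] over the chosen vertices is at most [d v], the excess of the
    full row yields a further neighbour of [v]; afterwards connectivity of [C] yields a neighbour of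
    some chosen vertex. *)
Lemma not_refuted fuel v l : uniq (v :: l) -> {subset v :: l <= C} ->
  (size l + fuel <= 4)%N -> (d v < \sum_(y in C) k v y)%N ->
  refuted fuel (config_of (v :: l)) = false.
Proof.
elim: fuel l => // fuel ih l ul lC szl dv.
have l4 : (size l <= 4)%N := leq_trans (leq_addr _ _) szl.
have ltlC : (size (v :: l) < #|C|)%N by apply: (leq_trans _ cardC); rewrite /= !ltnS (leq_trans l4).
have [y [yC yl kyl adm]] : exists y, [/\ y \in C, y \notin v :: l,
    (0 < sumn (map (k y) (v :: l)))%N &
    admissible (config_of (v :: l)) (map (k y) (v :: l))].
  have [le_d|gt_d] := leqP (\sum_(y <- v :: l) k v y) (d v).
    have : (exists2 y, y \in C :\: [set x in v :: l] & 0 < k v y)%N.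
      apply/exists_inP; apply: contraTT dv; rewrite negb_exists_in -leqNgt => /forall_inP h.
      apply: leq_trans le_d; rewrite (big_uniq _ ul) /= (bigID (mem (v :: l))) /=.
      rewrite [X in (_ + X)%N]big1 => [|y /andP[yC yl]]; last first.
        by apply/eqP; rewrite -leqn0 leqNgt; apply: h; rewrite !inE in yl *; rewrite yl.
      rewrite addn0 big_mkcond [X in (_ <= X)%N]big_mkcond; apply: leq_sum => y _.
      by case: (y \in v :: l); rewrite ?andbT ?andbF //; case: ifP.
    case=> y; rewrite !inE => /andP[yl yC] kvy; exists y; rewrite !inE yl yC.
    have sp : (0 < sumn (map (k y) (v :: l)))%N by rewrite /= kC addn_gt0 kvy.
    by split=> //; rewrite /admissible sp /= kC kvy implybT.
  have sD : [set x in v :: l] \subset C by apply/subsetP => x; rewrite inE => /lC.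
  have D0 : [set x in v :: l] != set0 by apply/set0Pn; exists v; rewrite inE mem_head.
  have DC : [set x in v :: l] != C.
    by apply: contraTneq ltlC => <-; rewrite cardsE (card_uniqP ul) ltnn.
  have [x [y [xl]]] := minimal_negative_connected _ _ _ _ kC _ minC _ sD D0 DC.
  have hD w : (w \in [set x in v :: l]) = (w \in v :: l) by rewrite in_set.
  rewrite in_setD !hD in xl * => /andP[yl yC] kxy; exists y.
  have sp : (0 < sumn (map (k y) (v :: l)))%N.
    by rewrite sumnE big_map (bigD1_seq x) //= kC addn_gt0 kxy.
  split=> //; rewrite /admissible sp /=; apply/implyP.
  move: gt_d; rewrite big_cons kxx !add0n /weight /= sumnE big_map.
  by move=> gt_d; rewrite leqNgt gt_d.
have uly : uniq (v :: rcons l y) by rewrite -rcons_cons rcons_uniq yl.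
have lyC : {subset v :: rcons l y <= C}.
  by move=> x; rewrite -rcons_cons mem_rcons inE => /predU1P[->|/lC].
have pos2 x y' (m : nat) : x \in C -> y' \in C -> x != y' ->
    nonpositive_at (config_of [:: x; y']) [:: m.+1; 1%N] = false.
  move=> xC yC' xy; apply: nonpositive_at_config_of => //=; first by rewrite inE xy.
  by move=> w; rewrite !inE => /orP[/eqP->|/eqP->].
have b3 x : x \in C -> (b x <= 3)%N.
  move=> xC; have xs : {subset [:: x] <= C} by move=> w; rewrite inE => /eqP->.
  have := nonpositive_at_config_of [:: x] [:: 1%N] erefl xs erefl.
  by rewrite /nonpositive_at /weight /mult /= kxx; lia.
have lt3 : all (fun m => m < 3)%N (map (k y) (v :: l)).
  apply/allP => _ /mapP[x xl ->].
  have xy : x != y by apply: contraNneq yl => <-.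
  have := pos2 x y 0%N (lC _ xl) yC xy.
  rewrite /nonpositive_at /weight /mult /= !kxx (kC y x).
  have := b0 x; have := b0 y; lia.
have fb : forbidden (config_of (v :: rcons l y)) = false.
  rewrite forbidden_config_of //= size_rcons !ltnS.
  by apply: leq_trans (leq_addr fuel _) _; rewrite -ltnS -addnS.
apply/negP => /(refutedS _ _ (b y) (map (k y) (v :: l))).
rewrite extend_config_of rcons_cons fb ih //; last by rewrite size_rcons addSnnS.
move=> h; apply: notF; apply: h => //; first by rewrite b0 b3.
have -> : size (config_of (v :: l)).1 = size (map (k y) (v :: l)) by rewrite !size_map.
exact: mem_rows.
Qed.

Lemma minimal_negative_large_absurd : False.
Proof.
have [v vC dv] := minimal_negative_nondominant _ _ _ _ kC _ minC.
have vCs : {subset [:: v] <= C} by move=> x; rewrite inE => /eqP->.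
have b3 : (0 < b v <= 3)%N.
  have := nonpositive_at_config_of [:: v] [:: 1%N] erefl vCs erefl.
  by rewrite /nonpositive_at /weight /mult /= kxx b0; lia.
have e : config_of [:: v] = ([:: b v], [:: [:: 0%N]]) by rewrite /config_of /= kxx.
have := not_refuted 4 v [::] erefl vCs erefl dv.
by rewrite e (refuted_single _ b3).
Qed.

End Refutation.

(** * Vertices outside a maximum clique *)

Lemma sum_card_disjoint (I T : finType) (P : {set I}) (F : I -> {set T}) :
  (forall x p q, p \in P -> q \in P -> x \in F p -> x \in F q -> p = q) ->
  (\sum_(p in P) #|F p| <= #|T|)%N.
Proof.
move=> dF; under eq_bigr do rewrite -sum1_card big_mkcond.
rewrite exchange_big -[X in (_ <= X)%N]sum1_card; apply: leq_sum => x _.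
rewrite -big_mkcondr sum1_card; apply/card_le1_eqP => p q /andP[pP xp] /andP[qP xq].
exact: (dF x).
Qed.

Lemma exists_subset_card (T : finType) (A : {set T}) m :
  (m <= #|A|)%N -> exists2 D : {set T}, D \subset A & #|D| = m.
Proof.
move=> mA; exists [set x in take m (enum A)].
  by apply/subsetP => x; rewrite inE => /mem_take; rewrite mem_enum.
rewrite cardsE (card_uniqP _) ?take_uniq ?enum_uniq // size_takel //.
by rewrite -cardE.
Qed.

Section CliqueExtension.
Variables (R : realFieldType) (V I : finType) (B : V -> {set I}) (e : rel V).

(* Vectors with inner products [1] on the clique [I] and [-1] exactly on [B x]:
   after completing the squares in the clique coordinates, the Gram form on the
   remaining ones has off-diagonal coefficients [- meet_mult x y], where [e]
   says that the inner product of [x] and [y] is [-1]. *)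
Definition meet_mult x y : nat :=
  if x == y then 0%N else (#|B x :&: B y| + if e x y then 2 else 0)%N.

Definition wsum (z : V -> R) : R := \sum_x (#|B x| + 2)%:R * z x.

Local Notation b := (fun x => #|B x|).
Local Notation k := meet_mult.
Local Notation d := (fun x => 4 - #|B x|)%N.
Local Notation tau := (#|I| + 4)%N.
Local Notation qf := (qform R V d k).
Local Notation lp := (lap R V d k).

Hypothesis eC : symmetric e.
Hypothesis b_bounds : forall x, (0 < #|B x| <= 4)%N.
Hypothesis b1_pair : forall x y, #|B x| = 1%N -> #|B y| = 1%N -> k x y <> 1%N.
Hypothesis cardI : (49 <= #|I|)%N.
Hypothesis form_ge0 : forall z, 0 <= qf z + wsum z ^+ 2 / tau%:R.

Lemma meet_multC x y : k x y = k y x.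
Proof. by rewrite /meet_mult eq_sym setIC eC. Qed.

Lemma meet_multxx x : k x x = 0%N.
Proof. by rewrite /meet_mult eqxx. Qed.

Lemma meet_mult_eq1 x y : k x y = 1%N -> #|B x :&: B y| = 1%N.
Proof.
rewrite /meet_mult; case: eqP => // _; case: (e x y).
  by rewrite addn2.
by rewrite addn0.
Qed.

Lemma meet_mult_eq0 x y : x != y -> k x y = 0%N -> [disjoint B x & B y].
Proof.
rewrite /meet_mult => /negbTE -> /eqP; rewrite addn_eq0 cards_eq0 => /andP[/eqP h _].
by rewrite -setI_eq0 h.
Qed.

Lemma meet_mult_gt0 x y i : x != y -> i \in B x -> i \in B y -> (0 < k x y)%N.
Proof.
move=> /negbTE xy ix iy; rewrite /meet_mult xy addn_gt0 card_gt0; apply/orP; left.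
by apply/set0Pn; exists i; rewrite inE ix.
Qed.

(** The singleton [B v] lies in both [B x] and [B y], so these meet. *)
Lemma b1_nbrs v x y : #|B v| = 1%N -> k v x = 1%N -> k v y = 1%N ->
  x != y -> k x y <> 0%N.
Proof.
move=> v1 /meet_mult_eq1 vx /meet_mult_eq1 vy xy /(meet_mult_eq0 _ _ xy).
have sub z : #|B v :&: B z| = 1%N -> B v \subset B z.
  by move=> vz; apply/setIidPl/eqP; rewrite eqEcard subsetIl v1 vz.
have /card_gt0P[i iv] : (0 < #|B v|)%N by rewrite v1.
move/pred0P => /(_ i) /=.
by rewrite (subsetP (sub _ vx) _ iv) (subsetP (sub _ vy) _ iv).
Qed.

(** Pigeonhole: three pairwise disjoint sets cannot each meet the two-element set [B v]. *)
Lemma b2_nbrs v x y w : #|B v| = 2%N -> k v x = 1%N -> k v y = 1%N ->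
  k v w = 1%N -> x != y -> x != w -> y != w ->
  k x y = 0%N -> k x w = 0%N -> k y w <> 0%N.
Proof.
move=> v2 /meet_mult_eq1 vx /meet_mult_eq1 vy /meet_mult_eq1 vw xy xw yw.
move=> /(meet_mult_eq0 _ _ xy) dxy /(meet_mult_eq0 _ _ xw) dxw /(meet_mult_eq0 _ _ yw) dyw.
have disj p q (F := fun p => B v :&: B p) :
    [disjoint B p & B q] -> #|F p :|: F q| = (#|F p| + #|F q|)%N.
  rewrite -setI_eq0 => /eqP pq; rewrite cardsU.
  suff -> : F p :&: F q = set0 by rewrite cards0 subn0.
  by rewrite /F setIACA setIid pq setI0.
have : (#|(B v :&: B x) :|: (B v :&: B y) :|: (B v :&: B w)| <= #|B v|)%N.
  by apply: subset_leq_card; rewrite !subUset !subsetIl.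
have dxyw : (B v :&: (B x :|: B y)) :&: (B v :&: B w) = set0.
  apply/eqP; rewrite setIACA setIid setIUl.
  move: dxw dyw; rewrite -!setI_eq0 => /eqP-> /eqP->.
  by rewrite setU0 setI0.
by rewrite -setIUr cardsU dxyw cards0 subn0 setIUr disj // vx vy vw v2.
Qed.

(** Test vectors with natural entries, with the denominator cleared, leave only integer
    arithmetic. *)
Lemma form_nat_ge0 (z : V -> nat) :
  (tau * (\sum_x \sum_y k x y * (z x * z y)) <=
   tau * (\sum_x (4 - #|B x|) * (z x * z x)) + (\sum_x (#|B x| + 2) * z x) ^ 2)%N.
Proof.
have := form_ge0 (fun x => (z x)%:R).
have -> : qf (fun x => (z x)%:R) =
   (\sum_x (4 - #|B x|) * (z x * z x))%N%:R - (\sum_x \sum_y k x y * (z x * z y))%N%:R.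
  rewrite /qform /bform /lap !natr_sum -sumrB; apply: eq_bigr => x _.
  rewrite natr_sum mulrBr mulr_sumr; congr (_ - _); first by rewrite !natrM; ring.
  by apply: eq_bigr => y _; rewrite !natrM; ring.
have -> : wsum (fun x => (z x)%:R) = (\sum_x (#|B x| + 2) * z x)%N%:R.
  by rewrite natr_sum; apply: eq_bigr => x _; rewrite natrM.
set q1 := (\sum_x (4 - _) * _)%N; set q2 := (\sum_x \sum_y _)%N; set w := (\sum_x (_ + 2) * _)%N.
have t0 : 0 < tau%:R :> R by rewrite ltr0n addn_gt0 orbT.
move: tau t0 => t t0.
rewrite -(pmulr_rge0 _ t0) mulrDr mulrBr mulrCA divff ?gt_eqF // mulr1.
by rewrite -(ler_nat R) natrD natrX !natrM; lra.
Qed.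

(** An excess [s] of the off-diagonal part over the diagonal part must be paid for by the square
    [w], and [tau >= 49 + 4 = 53]. *)
Lemma tau_cancel m q s w :
  (tau * m <= tau * q + w)%N -> m = (q + s)%N -> (53 * s <= w)%N.
Proof.
move=> + em; rewrite em mulnDr leq_add2l; apply: leq_trans.
by rewrite leq_mul2r; apply/orP; right; lia.
Qed.

(** Test the indicator of five such vertices, with [s] the sum of their weights. The off-diagonal
    part is at least 20, the diagonal part is [20 - s] and the linear form is [s + 10]; but
    [53 * s <= (s + 10) ^ 2] fails for [5 <= s <= 20]. *)
Lemma card_containing i : (#|[set x | i \in B x]| <= 4)%N.
Proof.
rewrite leqNgt; apply/negP => /exists_subset_card[D sD D5].
have iD x : x \in D -> i \in B x by move=> /(subsetP sD); rewrite inE.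
pose z x : nat := x \in D.
have := form_nat_ge0 z.
have zz F : (\sum_x F x * z x = \sum_(x in D) F x)%N.
  by rewrite [RHS]big_mkcond; apply: eq_bigr => x _; rewrite /z; case: ifP; lia.
have -> : (\sum_x (4 - #|B x|) * (z x * z x) = \sum_(x in D) (4 - #|B x|))%N.
  by rewrite -zz; apply: eq_bigr => x _; rewrite /z; case: (x \in D); lia.
rewrite zz.
have kge : (20 <= \sum_x \sum_y k x y * (z x * z y))%N.
  have -> : (\sum_x \sum_y k x y * (z x * z y) = \sum_(x in D) \sum_(y in D) k x y)%N.
    rewrite -zz; apply: eq_bigr => x _; rewrite -zz big_distrl; apply: eq_bigr => y _ /=.
    by rewrite mulnAC mulnA.
  have -> : 20%N = (\sum_(x in D) 4)%N by rewrite sum_nat_const D5.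
  apply: leq_sum => x xD; rewrite (bigD1 x) //= meet_multxx add0n.
  have -> : 4%N = (\sum_(y in D | y != x) 1)%N.
    have := D5; rewrite -sum1_card (bigD1 x) //=; lia.
  apply: leq_sum => y /andP[yD yx]; apply: (meet_mult_gt0 _ _ i); rewrite ?iD //.
  by rewrite eq_sym.
have sE : (\sum_(x in D) (4 - #|B x|) + \sum_(x in D) #|B x| = 20)%N.
  rewrite -big_split /=; have -> : 20%N = (\sum_(x in D) 4)%N by rewrite sum_nat_const D5.
  by apply: eq_bigr => x _; have := b_bounds x; lia.
rewrite big_split /= sum_nat_const D5.
have s5 : (5 <= \sum_(x in D) #|B x|)%N.
  by rewrite -D5 -sum1_card; apply: leq_sum => x _; have /andP[] := b_bounds x.
move: kge sE s5.
set q1 := (\sum_(x in D) (4 - _))%N; set s := (\sum_(x in D) #|_|)%N; set q2 := (\sum_x \sum_y _)%N.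
move=> kge sE s5 h.
have := tau_cancel 20 q1 s _ (leq_trans _ h); rewrite leq_mul2l kge orbT -sE => /(_ isT erefl).
have s20 : (s <= 20)%N by lia.
by rewrite expnS expn1; nia.
Qed.

(** The test vector is 2 at [x] and 1 on [Y]: each [y] gives two ordered pairs with multiplicity at
    least 2 and product 2, hence the 8. *)
Lemma star_bound x (Y : {set V}) : (forall y, y \in Y -> x != y /\ e x y) ->
  (tau * (8 * #|Y|) <= tau * (4 * (4 - #|B x|) + \sum_(y in Y) (4 - #|B y|))
     + (2 * (#|B x| + 2) + \sum_(y in Y) (#|B y| + 2)) ^ 2)%N.
Proof.
move=> eY; have xY : x \notin Y by apply/negP => /eY[]; rewrite eqxx.
pose z y : nat := if y == x then 2%N else y \in Y.
have zx : z x = 2%N by rewrite /z eqxx.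
have zz (F : V -> nat) : (F x = 0 -> \sum_y F y * z y = \sum_(y in Y) F y)%N.
  move=> Fx; rewrite [RHS]big_mkcond; apply: eq_bigr => y _; rewrite /z.
  by case: eqP => [->|_]; [rewrite Fx mul0n if_same|case: ifP; lia].
have yx y : y \in Y -> (y == x) = false by move=> /eY[]; rewrite eq_sym => /negbTE.
have := form_nat_ge0 z.
have -> : (\sum_y (4 - #|B y|) * (z y * z y) =
   4 * (4 - #|B x|) + \sum_(y in Y) (4 - #|B y|))%N.
  rewrite (bigD1 x) //= zx; congr (_ + _)%N; first by rewrite mulnC.
  rewrite [RHS]big_mkcond [RHS](bigD1 x) //= (negbTE xY) add0n.
  by apply: eq_bigr => y /negbTE nyx; rewrite /z nyx; case: ifP; lia.
have -> : (\sum_y (#|B y| + 2) * z y = 2 * (#|B x| + 2) + \sum_(y in Y) (#|B y| + 2))%N.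
  rewrite (bigD1 x) //= zx; congr (_ + _)%N; first by rewrite mulnC.
  rewrite [RHS]big_mkcond [RHS](bigD1 x) //= (negbTE xY) add0n.
  by apply: eq_bigr => y /negbTE nyx; rewrite /z nyx; case: ifP; lia.
apply: leq_trans; rewrite leq_mul2l; apply/orP; right.
have kx y : y \in Y -> (2 <= k x y)%N.
  by move=> /eY[/negbTE xy exy]; rewrite /meet_mult xy exy leq_addl.
have row : (4 * #|Y| <= \sum_y k x y * (z x * z y))%N.
  have -> : (\sum_y k x y * (z x * z y) = \sum_(y in Y) k x y * 2)%N.
    rewrite -zz ?meet_multxx //; apply: eq_bigr => y _.
    by rewrite zx mulnA.
  rewrite mulnC -sum_nat_const; apply: leq_sum => y /kx; lia.
rewrite (bigD1 x) //= -[8%N]/(4 + 4)%N mulnDl leq_add //.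
apply: (@leq_trans (\sum_(y in Y) k y x * (z y * z x))%N).
  rewrite mulnC -sum_nat_const; apply: leq_sum => y yY.
  rewrite meet_multC zx; have -> : z y = 1%N by rewrite /z yx // yY.
  by have := kx y yY; lia.
rewrite big_mkcond [X in (_ <= X)%N]big_mkcond; apply: leq_sum => y _.
by case: ifP => // yY; rewrite yx //= (bigD1 x) //= leq_addr.
Qed.

(** Let [s] be the sum of the weights over [Y] and [b = |B x|]. Two neighbours at [b = 4] would need
    [53 * (8 + s) <= (s + 16) ^ 2] with [s <= 8]; four neighbours at [b <= 3] would need
    [53 * (4 * b + s) <= (2 * b + s + 12) ^ 2] with [s <= 16]. *)
Lemma card_e_nbrs x : (#|[set y | (x != y) && e x y]| <= if #|B x| == 4 then 1 else 3)%N.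
Proof.
rewrite leqNgt; apply/negP => /exists_subset_card[Y sY cY].
have eY y : y \in Y -> x != y /\ e x y by move=> /(subsetP sY); rewrite inE => /andP.
have sE : (\sum_(y in Y) (4 - #|B y|) + \sum_(y in Y) #|B y| = 4 * #|Y|)%N.
  rewrite -big_split /= mulnC -sum_nat_const.
  by apply: eq_bigr => y _; have := b_bounds y; lia.
have s1 : (#|Y| <= \sum_(y in Y) #|B y|)%N.
  by rewrite -sum1_card; apply: leq_sum => y _; have /andP[] := b_bounds y.
have := star_bound x Y eY; rewrite big_split /= sum_nat_const.
move: sE s1; rewrite cY; have := b_bounds x.
move: (\sum_(x in Y) (4 - _))%N (\sum_(y in Y) #|B y|)%N (#|B x|) => q s bx.
case: eqP => [-> _|_ bx4] sE s1 h.
  have := tau_cancel _ _ (8 + s) _ h; rewrite expnS expn1 => /(_ ltac:(lia)).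
  have s8 : (s <= 8)%N by lia.
  by nia.
have := tau_cancel _ _ (4 * bx + s) _ h; rewrite expnS expn1 => /(_ ltac:(lia)).
have : (s <= 16)%N by lia.
by case/andP: bx4 => + +; case: bx {h} => [|[|[|[|[|bx]]]]] // _ _; nia.
Qed.


(** * Neighbourhoods and the kernel of the reduced form *)

Implicit Types z u v : V -> R.

Definition neighbours x : {set V} := [set y | (0 < k x y)%N].

(** A neighbour is related to [x] by [e] or shares an element of [B x], and each such element lies
    in at most three further sets. This gives [1 + 4 * 3 = 13] for weight 4 and at most
    [3 + 3 * 3 = 12] otherwise. *)
Lemma card_neighbours x : (#|neighbours x| <= 13)%N.
Proof.
have sub : neighbours x \subset
   [set y | (x != y) && e x y] :|: \bigcup_(i in B x) ([set y | i \in B y] :\ x).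
  apply/subsetP => y; rewrite !inE /meet_mult.
  have [->|xy] := eqVneq x y => //=; case: (e x y) => //=.
  rewrite addn0 card_gt0 => /set0Pn[i]; rewrite inE => /andP[ix iy].
  by apply/bigcupP; exists i; rewrite // !inE eq_sym xy.
have cU : (#|\bigcup_(i in B x) ([set y | i \in B y] :\ x)| <= #|B x| * 3)%N.
  rewrite -sum_nat_const.
  apply: (big_ind2 (fun (A : {set V}) m => #|A| <= m)%N) => [|A m C p Am Cp|i ix].
  - by rewrite cards0.
  - by apply: leq_trans (leq_add Am Cp); rewrite cardsU leq_subr.
  have := cardsD1 x [set y | i \in B y]; rewrite inE ix /= => h.
  by rewrite -ltnS -add1n -h card_containing.
apply: leq_trans (subset_leq_card sub) _; rewrite cardsU; apply: leq_trans (leq_subr _ _) _.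
apply: leq_trans (leq_add (card_e_nbrs x) cU) _.
have := b_bounds x; case: eqP => [-> //|]; case: (#|B x|) => [|[|[|[|[|m]]]]] //.
Qed.

Lemma sum_lap_kernel z : (forall x, lp z x + (#|B x| + 2)%:R * (wsum z / tau%:R) = 0) ->
  qf z + wsum z ^+ 2 / tau%:R = 0.
Proof.
move=> kz; rewrite /qform /bform expr2 -mulrA {1}/wsum mulr_suml -big_split big1 // => x _ /=.
by have := congr1 ( *%R (z x)) (kz x); rewrite mulr0 => <-; ring.
Qed.

Lemma wsum_abs_eq0 z : wsum (fun x => `|z x|) = 0 -> forall x, z x = 0.
Proof.
move=> /eqP; rewrite psumr_eq0 => [/allP h x|x _]; last by rewrite mulr_ge0.
have := h x (mem_index_enum x); rewrite /= mulf_eq0 normr_eq0 pnatr_eq0 addn2 /=.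
by move/eqP.
Qed.

Lemma wsum_comb u v s : wsum (fun x => u x + s * v x) = wsum u + s * wsum v.
Proof. by rewrite /wsum mulr_sumr -big_split; apply: eq_bigr => x _ /=; ring. Qed.

Lemma tau_gt0 : 0 < tau%:R :> R.
Proof. by rewrite ltr0n addn_gt0 orbT. Qed.

Lemma kernel_bound_negative (z0 : V -> R) : qf z0 < 0 ->
  exists P : {set V}, (#|P| <= 84)%N /\
   forall z, (forall x, lp z x + (#|B x| + 2)%:R * (wsum z / tau%:R) = 0) ->
     (forall x, x \in P -> z x = 0) -> forall x, z x = 0.
Proof.
move=> /minimal_negative_exists[C minC].
have C6 : (#|C| <= 6)%N.
  rewrite leqNgt; apply/negP => C7.
  have b0 x : (0 < #|B x|)%N by case/andP: (b_bounds x).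
  exact: (minimal_negative_large_absurd R V b k meet_multC meet_multxx b0 b1_pair
           b1_nbrs b2_nbrs C minC C7).
exists (\bigcup_(x in C) (x |: neighbours x)); split.
  apply: (@leq_trans (#|C| * 14)%N); last by rewrite -[84%N]/(6 * 14)%N leq_mul2r C6 orbT.
  rewrite -sum_nat_const.
  apply: (big_ind2 (fun (A : {set V}) m => #|A| <= m)%N) => [|A m D p Am Dp|x _].
  - by rewrite cards0.
  - by apply: leq_trans (leq_add Am Dp); rewrite cardsU leq_subr.
  rewrite cardsU1 -[14%N]/(1 + 13)%N; apply: leq_add; first by case: (_ \notin _).
  exact: card_neighbours.
move=> z kz zP; have [[y [y0 yC qy]] _] := minC.
have t0 := tau_gt0.
pose a x := `|z x|.
have qa : qf a <= 0.
  apply: le_trans (qform_abs_le _ _ _ _ _) _; have := sum_lap_kernel z kz.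
  have : 0 <= wsum z ^+ 2 / tau%:R by rewrite divr_ge0 ?sqr_ge0 // ltW.
  by lra.
have [wa|wa] := eqVneq (wsum a) 0; first exact: wsum_abs_eq0.
have ya : bform R V d k y a = 0.
  apply: bform_disjoint => x w yx aw.
  have xC : x \in C by apply: contraNT yx => /yC ->.
  have nw : w \notin \bigcup_(x in C) (x |: neighbours x).
    by apply: contraNN aw => /zP; rewrite /a => ->; rewrite normr0.
  split; first by apply: contraNneq nw => <-; apply/bigcupP; exists x => //; rewrite setU11.
  apply/eqP; rewrite -leqn0 leqNgt; apply: contraNN nw => kxw.
  by apply/bigcupP; exists x => //; rewrite !inE kxw orbT.
(* This multiple of [a] cancels [wsum y]. As [y] and [a] do not interact, the form at the sum is
   [qf y < 0] plus a nonpositive term. *)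
have := form_ge0 (fun x => y x + (- wsum y / wsum a) * a x).
rewrite wsum_comb divfK // subrr expr0n mul0r addr0 qform_comb; last exact: meet_multC.
rewrite ya mulr0 addr0 => h.
have : (- wsum y / wsum a) ^+ 2 * qf a <= 0 by rewrite mulr_ge0_le0 ?sqr_ge0.
lra.
Qed.

Definition component x : {set V} := [set y | connect (fun x y => 0 < k x y)%N x y].

Lemma kernel_bound_nonnegative : (forall z, 0 <= qf z) -> (3 <= #|V| + #|I|)%N ->
  exists P : {set V}, (3 * #|P| + 3 <= #|V| + #|I|)%N /\
   forall z, (forall x, lp z x + (#|B x| + 2)%:R * (wsum z / tau%:R) = 0) ->
     (forall x, x \in P -> z x = 0) -> forall x, z x = 0.
Proof.
move=> q0 VI3; pose r : rel V := fun x y => (0 < k x y)%N.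
have rs : symmetric r by move=> x y; rewrite /r meet_multC.
have cs : connect_sym r := sym_connect_sym rs.
(* One root for each component that may be singular: an isolated vertex with diagonal entry 0, or a
   component with an edge. *)
pose Q : {set V} := [set x | (fingraph.root r x == x) && ((#|B x| == 4) || [exists y, r x y])].
(* Each root is charged to its component and to the union [F] of the sets [B y] over it. An isolated
   vertex of weight 4 has four elements in [F]; otherwise there are two vertices and at least one
   element. A shared element of [I] would be an edge, so distinct components have disjoint
   charges. *)
have cQ : (3 * #|Q| <= #|V| + #|I|)%N.
  pose F x := \bigcup_(y in component x) B y.
  have eqQ p q : p \in Q -> q \in Q -> connect r p q -> p = q.
    rewrite !inE => /andP[/eqP rp _] /andP[/eqP rq _].
    by rewrite -(root_connect cs) rp rq => /eqP.
  apply: (@leq_trans (\sum_(p in Q) #|component p| + \sum_(p in Q) #|F p|)%N).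
    rewrite -big_split /= mulnC -sum_nat_const; apply: leq_sum => p.
    rewrite inE => /andP[_ /orP[/eqP b4|/existsP[y ry]]].
      apply: (@leq_trans #|F p|); last exact: leq_addl.
      apply: (@leq_trans #|B p|); first by rewrite b4.
      by apply: subset_leq_card; apply: bigcup_sup; rewrite inE connect0.
    rewrite -[3%N]/(2 + 1)%N; apply: leq_add.
      have yp : p != y by apply: contraTneq ry => <-; rewrite /r meet_multxx.
      apply: (@leq_trans #|[set p; y]|); first by rewrite cards2 yp.
      apply: subset_leq_card; apply/subsetP => w; rewrite !inE => /orP[]/eqP->.
        exact: connect0.
      exact: connect1.
    apply: (@leq_trans #|B p|); first by case/andP: (b_bounds p).
    by apply: subset_leq_card; apply: bigcup_sup; rewrite inE connect0.
  apply: leq_add; apply: sum_card_disjoint => x p q pQ qQ.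
    rewrite !inE => px qx; apply: eqQ => //.
    by apply: connect_trans px _; rewrite cs.
  case/bigcupP => u; rewrite inE => pu xu /bigcupP[v]; rewrite inE => qv xv.
  apply: eqQ => //; apply: connect_trans pu _; rewrite cs; apply: connect_trans qv _.
  have [->|vu] := eqVneq v u; first exact: connect0.
  by apply: connect1; rewrite /r (meet_mult_gt0 _ _ x).
(* A zero at the root spreads through the component of [|u|]; a component without root in [Q] is a
   single vertex with positive diagonal entry. *)
have null u : (forall x, lp u x = 0) -> (forall x, x \in Q -> u x = 0) -> forall x, u x = 0.
  move=> lu uQ.
  have qu : qf (fun x => `|u x|) = 0.
    apply/eqP; rewrite eq_le q0 andbT; apply: le_trans (qform_abs_le _ _ _ _ _) _.
    by rewrite /qform /bform big1 // => x _; rewrite lu mulr0.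
  have la := lap_eq0_of_ge0 _ _ _ _ meet_multC _ q0 qu.
  move=> x; apply/eqP; rewrite -normr_eq0; apply/eqP.
  apply: (lap0_connected _ _ _ _ _ (fingraph.root r x) x _ la) => //.
    by rewrite cs connect_root.
  have [/uQ ->|] := boolP (fingraph.root r x \in Q); first by rewrite normr0.
  rewrite inE (root_root cs) eqxx /= negb_or => /andP[b4 /existsPn nor].
  have := lu (fingraph.root r x); rewrite /lap big1 => [|y _]; last first.
    by have := nor y; rewrite /r -leqNgt leqn0 => /eqP ->; rewrite mul0r.
  rewrite subr0 => /eqP; rewrite mulf_eq0 pnatr_eq0 => /orP[|/eqP->]; last by rewrite normr0.
  by have := b_bounds (fingraph.root r x); lia.
have ker z : (forall x, lp z x + (#|B x| + 2)%:R * (wsum z / tau%:R) = 0) ->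
    wsum z = 0 /\ forall x, lp z x = 0.
  move=> kz; have t0 := tau_gt0; have := sum_lap_kernel z kz; have := q0 z.
  have w0 : 0 <= wsum z ^+ 2 / tau%:R by rewrite divr_ge0 ?sqr_ge0 // ltW.
  move=> qz h; have /eqP : wsum z ^+ 2 / tau%:R = 0 by lra.
  rewrite mulf_eq0 invr_eq0 (gt_eqF t0) orbF sqrf_eq0 => /eqP wz; split=> // x.
  by have := kz x; rewrite wz mul0r mulr0 addr0.
have [Q0|[p pQ]] := set_0Vmem Q.
  exists set0; rewrite cards0; split=> // z /ker[_ lz] _; apply: null => // x.
  by rewrite Q0 inE.
exists (Q :\ p); split.
  by apply: leq_trans cQ; rewrite (cardsD1 p Q) pQ mulnDr addnC.
move=> z /ker[wz lz] zP.
(* This sign makes [z + s * |z|] vanish at [p], hence everywhere by [null]. Since [wsum z = 0], also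
   [wsum |z| = 0], which saves the root [p]. *)
pose s : R := if 0 <= z p then -1 else 1.
have la x : lp (fun x => `|z x|) x = 0.
  apply: lap_eq0_of_ge0 => //; first exact: meet_multC.
  apply/eqP; rewrite eq_le q0 andbT; apply: le_trans (qform_abs_le _ _ _ _ _) _.
  by rewrite /qform /bform big1 // => w _; rewrite lz mulr0.
have zs x : z x + s * `|z x| = 0.
  apply: (null (fun x => z x + s * `|z x|)) => {x} x.
    transitivity (lp z x + s * lp (fun x => `|z x|) x); last by rewrite lz la mulr0 addr0.
    rewrite /lap mulrBr mulr_sumr addrACA -opprD -big_split /=; congr (_ - _); first by ring.
    by apply: eq_bigr => y _; ring.
  have [->|xp] := eqVneq x p.
    by rewrite /s; case: (leP 0 (z p)) => zp _; [rewrite ger0_norm|rewrite ltr0_norm]; lra.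
  by move=> xQ; rewrite zP ?normr0 ?mulr0 ?addr0 // in_setD1 xp xQ.
apply: wsum_abs_eq0; have : wsum (fun x => z x + s * `|z x|) = 0.
  by apply: big1 => x _; rewrite zs mulr0.
rewrite wsum_comb wz add0r => /eqP; rewrite mulf_eq0 => /orP[|/eqP //].
by rewrite /s; case: ifP => _; rewrite ?oppr_eq0 oner_eq0.
Qed.

Lemma kernel_bound : (277 <= #|V| + #|I|)%N ->
  exists P : {set V}, (3 * #|P| + 3 <= #|V| + #|I|)%N /\
   forall z, (forall x, lp z x + (#|B x| + 2)%:R * (wsum z / tau%:R) = 0) ->
     (forall x, x \in P -> z x = 0) -> forall x, z x = 0.
Proof.
move=> n277; case: (pselect (forall z, 0 <= qf z)) => [q0|/existsNP[z0 /negP]].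
  by apply: kernel_bound_nonnegative => //; apply: leq_trans n277.
(* The size condition reads [3 * 84 + 3 = 255 <= 277]. *)
rewrite -ltNge => /kernel_bound_negative[P [P84 hP]]; exists P; split=> //.
by apply: leq_trans n277; lia.
Qed.

End CliqueExtension.

(** * From a Gram matrix to the weighted graph *)

Section GramBlocks.
Variables (R : realFieldType) (V I : finType) (N : V -> {set I}) (e : rel V).
Implicit Types (u : I -> R) (z : V -> R).

(** Rows of a matrix with diagonal 5 and other entries 1 or -1, written as the all-ones matrix plus
    4 on the diagonal minus 2 at each entry -1. *)
Definition total u z : R := \sum_i u i + \sum_v z v.
Definition clique_row u z i : R := 4 * u i + total u z - 2 * \sum_(v | i \in N v) z v.
Definition outer_row u z v : R :=
  4 * z v + total u z - 2 * \sum_(i in N v) u i - 2 * \sum_(w | e v w) z w.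

Local Notation tau := (#|I| + 4)%N.
Local Notation k := (meet_mult V I N e).
Local Notation W := (wsum R V I N).

(* For given [z], the values on the clique that make its rows vanish. *)
Definition clique_part z i : R := (\sum_(v | i \in N v) z v - W z / tau%:R) / 2.

Hypothesis eI : irreflexive e.

Let tau_neq0 : tau%:R != 0 :> R.
Proof. by rewrite pnatr_eq0 addn_eq0 andbF. Qed.

Lemma sum_incidence z : \sum_i \sum_(v | i \in N v) z v = \sum_v #|N v|%:R * z v.
Proof.
rewrite (exchange_big_dep xpredT) //=; apply: eq_bigr => v _.
by rewrite mulr_natl -sumr_const; apply: eq_bigl => i.
Qed.

(** Adding up the vanishing clique rows gives [tau * total = 2 * W z], the origin of the
    coefficients [#|N v| + 2] in [wsum]. *)
Lemma total_clique_part z : total (clique_part z) z = 2 * (W z / tau%:R).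
Proof.
rewrite /total /clique_part -mulr_suml sumrB sum_incidence sumr_const.
have -> : \sum_v #|N v|%:R * z v = W z - 2 * \sum_v z v.
  rewrite /wsum mulr_sumr -sumrB; apply: eq_bigr => v _.
  by rewrite natrD; ring.
have -> : W z / tau%:R *+ #|I| = W z - 4 * (W z / tau%:R).
  rewrite -mulr_natl; have -> : (#|I|%:R = tau%:R - 4 :> R) by rewrite natrD addrK.
  by rewrite mulrBl mulrCA divff ?mulr1.
by move: (W z / tau%:R) => x; lra.
Qed.

Lemma clique_row_clique_part z i : clique_row (clique_part z) z i = 0.
Proof.
rewrite /clique_row total_clique_part /clique_part.
by move: (W z / tau%:R) => x; lra.
Qed.

(** The Schur complement of the clique block: the incidence sums produce the intersections
    [N v :&: N w], whose diagonal case lowers 4 to [4 - #|N v|]. *)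
Lemma outer_row_clique_part z v : outer_row (clique_part z) z v =
  (4 - #|N v|%:R) * z v - \sum_w (k v w)%:R * z w + (#|N v| + 2)%:R * (W z / tau%:R).
Proof.
rewrite /outer_row total_clique_part.
have -> : \sum_w (k v w)%:R * z w =
    \sum_w #|N v :&: N w|%:R * z w - #|N v|%:R * z v + 2 * \sum_(w | e v w) z w.
  rewrite (bigD1 v) //= /meet_mult eqxx mul0r add0r.
  rewrite [\sum_w #|N v :&: _|%:R * _](bigD1 v) //= setIid (addrC (_ * z v)) addrK.
  rewrite [\sum_(w | e v w) _]big_mkcond [\sum_w (if _ then _ else _)](bigD1 v) //= eI add0r.
  rewrite mulr_sumr -big_split; apply: eq_bigr => w /negbTE wv /=.
  by rewrite eq_sym wv natrD; case: (e v w); ring.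
have -> : 2 * \sum_(i in N v) clique_part z i =
    \sum_w #|N v :&: N w|%:R * z w - #|N v|%:R * (W z / tau%:R).
  have -> : 2 * \sum_(i in N v) clique_part z i =
      \sum_(i in N v) (\sum_(w | i \in N w) z w - W z / tau%:R).
    by rewrite mulr_sumr; apply: eq_bigr => i _; rewrite /clique_part mulrC divfK ?pnatr_eq0.
  rewrite sumrB sumr_const -[_ *+ _]mulr_natl; congr (_ - _).
  rewrite (exchange_big_dep xpredT) //=; apply: eq_bigr => w _.
  by rewrite mulr_natl -sumr_const; apply: eq_bigl => i; rewrite !inE.
by rewrite natrD; ring.
Qed.

(** The clique block is 4 times the identity plus the all-ones matrix, hence invertible. *)
Lemma clique_row_inj u u' z : (forall i, clique_row u z i = 0) ->
  (forall i, clique_row u' z i = 0) -> u =1 u'.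
Proof.
move=> ru ru' i; pose D := \sum_i (u i - u' i).
have h j : 4 * (u j - u' j) + D = 0.
  rewrite /D sumrB; have := ru j; have := ru' j; rewrite /clique_row /total; lra.
have D0 : tau%:R * D = 0.
  have : \sum_i (4 * (u i - u' i) + D) = 0 by apply: big1.
  by rewrite big_split /= -mulr_sumr -/D sumr_const natrD -mulr_natl => h'; lra.
have : D = 0 by apply/eqP; move/eqP: D0; rewrite mulf_eq0 (negbTE tau_neq0).
by have := h i; lra.
Qed.

Hypothesis eC : symmetric e.
Hypothesis psd : forall u z,
  0 <= \sum_i u i * clique_row u z i + \sum_v z v * outer_row u z v.
Hypothesis N_gt0 : forall v, (0 < #|N v|)%N.
Hypothesis N_half : forall v, (2 * #|N v| <= #|I|)%N.
Hypothesis b1_pair : forall x y, #|N x| = 1%N -> #|N y| = 1%N -> k x y <> 1%N.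
Hypothesis cardI : (49 <= #|I|)%N.

Lemma outer_form_ge0 z :
  0 <= \sum_v z v * ((4 - #|N v|%:R) * z v - \sum_w (k v w)%:R * z w
                     + (#|N v| + 2)%:R * (W z / tau%:R)).
Proof.
have := psd (clique_part z) z; rewrite big1 ?add0r; last first.
  by move=> i _; rewrite clique_row_clique_part mulr0.
by under eq_bigr do rewrite outer_row_clique_part.
Qed.

(** At a unit vector the reduced form is [4 - b + (b + 2) ^ 2 / tau], which is negative for
    [b >= 5]. *)
Lemma card_N_le4 v : (#|N v| <= 4)%N.
Proof.
have := outer_form_ge0 (fun w => (w == v)%:R).
have delta (F : V -> R) : \sum_w F w * (w == v)%:R = F v.
  rewrite (bigD1 v) //= eqxx mulr1 big1 ?addr0 // => w /negbTE ->.
  by rewrite mulr0.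
under eq_bigr do rewrite mulrC; rewrite delta delta eqxx mulr1 /wsum delta.
rewrite meet_multxx subr0 => h.
rewrite leqNgt; apply/negP => b5; move: h; apply/negP; rewrite -ltNge.
have t0 : 0 < tau%:R :> R by rewrite ltr0n addn_gt0 orbT.
rewrite -(pmulr_rlt0 _ t0) mulrDr mulrCA [_ * (_ / _)]mulrCA divff // mulr1.
have : ((#|N v| + 2) * (#|N v| + 2) + tau * 4 < tau * #|N v|)%N.
  have := N_half v; move: cardI b5; move: #|N v| #|I| => b t t49 b5 bt.
  (* For [b >= 11], [N_half] gives [t + 4 >= 2 * (b + 2)] and [b + 2 < 2 * (b - 4)]; for smaller [b]
     the bound [t >= 49] is enough. *)
  have [b10|b11] := leqP b 10; last by nia.
  by move: b b5 b10 {bt} => [|[|[|[|[|[|[|[|[|[|[|b]]]]]]]]]]] //= _ _; lia.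
by rewrite -(ltr_nat R) natrD !natrM; lra.
Qed.

Lemma gram_kernel_bound : (277 <= #|V| + #|I|)%N ->
  exists P : {set V}, (3 * #|P| + 3 <= #|V| + #|I|)%N /\
   forall u z, (forall i, clique_row u z i = 0) -> (forall v, outer_row u z v = 0) ->
     (forall v, v \in P -> z v = 0) -> (forall i, u i = 0) /\ (forall v, z v = 0).
Proof.
move=> n277.
have b_bounds v : (0 < #|N v| <= 4)%N by rewrite N_gt0 card_N_le4.
have lapE z v : lap R V (fun x => 4 - #|N x|)%N k z v =
    (4 - #|N v|%:R) * z v - \sum_w (k v w)%:R * z w.
  by rewrite /lap natrB ?card_N_le4.
have form_ge0 z : 0 <= qform R V (fun x => 4 - #|N x|)%N k z + W z ^+ 2 / tau%:R.
  apply: le_trans (outer_form_ge0 z) _; rewrite /qform /bform.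
  have -> : W z ^+ 2 / tau%:R = \sum_v (#|N v| + 2)%:R * z v * (W z / tau%:R).
    by rewrite expr2 -mulrA {1}/wsum mulr_suml.
  rewrite -big_split /=; apply: ler_sum => v _.
  by rewrite lapE; lra.
have [P [cP hP]] := kernel_bound R V I N e eC b_bounds b1_pair cardI form_ge0 n277.
exists P; split=> // u z ru rz zP.
have uE := clique_row_inj _ _ _ ru (clique_row_clique_part z).
have z0 : forall v, z v = 0.
  apply: hP => // v; rewrite lapE -outer_row_clique_part -[RHS](rz v).
  rewrite /outer_row /total; congr (_ + (_ + _) - _ * _ - _).
    by apply: eq_bigr => i _; rewrite uE.
  by apply: eq_bigr => i _; rewrite uE.
split=> // i; rewrite uE /clique_part /wsum !big1 ?mul0r ?subrr ?mul0r // => v _.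
by rewrite z0 mulr0.
Qed.

End GramBlocks.

(** * Gram matrices with a maximum clique *)

Section GramMatrix.
Variables (R : realFieldType) (T : finType) (G : T -> T -> R) (A : {set T}).
Hypothesis GC : forall x y, G x y = G y x.
Hypothesis Gdiag : forall x, G x x = 5.
Hypothesis Goff : forall x y, x != y -> G x y = 1 \/ G x y = -1.
Hypothesis psd : forall f : T -> R, 0 <= \sum_x f x * \sum_y G x y * f y.

Definition gram_clique (D : {set T}) : Prop :=
  forall x y, x \in D -> y \in D -> x != y -> G x y = 1.

Hypothesis cliqueA : gram_clique A.
Hypothesis maxA : forall D, gram_clique D -> (#|D| <= #|A|)%N.
Hypothesis cardA : (49 <= #|A|)%N.
Hypothesis halfA : forall x, x \notin A -> (2 * #|[set i in A | G i x == -1%R]| <= #|A|)%N.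

Local Notation V := {x : T | x \notin A}.
Local Notation I := {x : T | x \in A}.

Definition minus_nbrs (v : V) : {set I} := [set i | G (val i) (val v) == -1].
Definition minus_rel : rel V := fun v w => (v != w) && (G (val v) (val w) == -1).

Lemma sum_clique_split (F : T -> R) :
  \sum_x F x = \sum_(i : I) F (val i) + \sum_(v : V) F (val v).
Proof.
rewrite (bigID (mem A)) /=; congr (_ + _); first by rewrite big_sub.
by rewrite (big_sub (fun x => x \notin A)).
Qed.

Lemma sum_indicators (U : finType) (z : U -> R) (c : U -> R) (P : pred U) :
  \sum_w (1 + c w - 2 * (P w)%:R) * z w =
  \sum_w z w + \sum_w c w * z w - 2 * \sum_(w | P w) z w.
Proof.
rewrite [\sum_(w | P w) _]big_mkcond mulr_sumr -big_split -sumrB.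
by apply: eq_bigr => w _ /=; case: (P w) => /=; ring.
Qed.

Lemma G_off x y : x != y -> G x y = 1 + 0 - 2 * (G x y == -1)%:R.
Proof.
move=> /Goff[->|->]; last by rewrite eqxx /=; ring.
by rewrite -subr_eq0 opprK -[1 + 1]/(2%:R) pnatr_eq0 /=; ring.
Qed.

Lemma sum_delta (U : finType) (z : U -> R) v :
  \sum_w (4 * (w == v)%:R) * z w = 4 * z v.
Proof.
rewrite (bigD1 v) //= eqxx big1 => [|w /negbTE ->] /=; first by ring.
by ring.
Qed.

Lemma sum0 (U : finType) (z : U -> R) : \sum_w 0 * z w = 0.
Proof. by apply: big1 => w _; rewrite mul0r. Qed.

Lemma valIV (i : I) (v : V) : val i != val v.
Proof. by apply: contraTneq (valP i) => ->; exact: valP v. Qed.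

Lemma clique_rowE f i : \sum_y G (val i) y * f y =
  clique_row R V I minus_nbrs (fun j => f (val j)) (fun v => f (val v)) i.
Proof.
rewrite sum_clique_split /clique_row /total.
have -> : \sum_(j : I) G (val i) (val j) * f (val j) =
   \sum_(j : I) (1 + 4 * (j == i)%:R - 2 * false%:R) * f (val j).
  apply: eq_bigr => j _; congr (_ * _); have [->|ji] := eqVneq j i.
    by rewrite Gdiag /=; ring.
  by rewrite cliqueA ?(valP i) ?(valP j) //; [by move=> /=; ring|by rewrite eq_sym].
have -> : \sum_(v : V) G (val i) (val v) * f (val v) =
   \sum_(v : V) (1 + 0 - 2 * (i \in minus_nbrs v)%:R) * f (val v).
  by apply: eq_bigr => v _; rewrite inE -G_off ?valIV.
rewrite (sum_indicators _ _ (fun=> 0)) (sum_indicators _ _ _ pred0) sum0 sum_delta.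
have -> : \sum_(j : I | pred0 j) f (val j) = 0 by rewrite big_pred0.
by ring.
Qed.

Lemma outer_rowE f v : \sum_y G (val v) y * f y =
  outer_row R V I minus_nbrs minus_rel (fun j => f (val j)) (fun v => f (val v)) v.
Proof.
rewrite sum_clique_split /outer_row /total.
have -> : \sum_(i : I) G (val v) (val i) * f (val i) =
   \sum_(i : I) (1 + 0 - 2 * (i \in minus_nbrs v)%:R) * f (val i).
  by apply: eq_bigr => i _; rewrite inE -G_off ?valIV // GC.
have -> : \sum_(w : V) G (val v) (val w) * f (val w) =
   \sum_(w : V) (1 + 4 * (w == v)%:R - 2 * (minus_rel v w)%:R) * f (val w).
  apply: eq_bigr => w _; congr (_ * _); rewrite /minus_rel; have [->|wv] := eqVneq w v.
    by rewrite Gdiag /=; ring.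
  have vw : v != w by rewrite eq_sym.
  by rewrite [LHS]G_off ?(inj_eq val_inj) //=; ring.
rewrite (sum_indicators _ _ (fun=> 0)) sum_indicators sum0 sum_delta.
by ring.
Qed.

Definition combine (u : I -> R) (z : V -> R) x : R :=
  \sum_(i : I | val i == x) u i + \sum_(v : V | val v == x) z v.

Lemma combine_clique u z (i : I) : combine u z (val i) = u i.
Proof.
rewrite /combine (big_pred1 i) => [|j]; last by rewrite (inj_eq val_inj).
by rewrite big_pred0 ?addr0 // => v; rewrite eq_sym; apply/negbTE/valIV.
Qed.

Lemma combine_outer u z (v : V) : combine u z (val v) = z v.
Proof.
rewrite /combine [X in _ + X](big_pred1 v) => [|w]; last by rewrite (inj_eq val_inj).
by rewrite big_pred0 ?add0r // => i; apply/negbTE/valIV.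
Qed.

Lemma card_clique_type : #|{: I}| = #|A|.
Proof. by rewrite card_sig; apply: eq_card. Qed.

Lemma card_clique_split : (#|{: V}| + #|{: I}|)%N = #|T|.
Proof. by rewrite !card_sig addnC; exact: cardC (mem A). Qed.

Lemma minus_nbrsE v : #|minus_nbrs v| = #|[set i in A | G i (val v) == -1%R]|.
Proof.
rewrite -(card_imset _ val_inj); apply: eq_card => x; rewrite inE.
apply/imsetP/andP => [[i]|[xA Gx]].
  by rewrite inE => h ->; split=> //; exact: valP i.
by exists (Sub x xA); rewrite ?inE ?SubK.
Qed.

(** Otherwise [v] could be added to the maximum clique. *)
Lemma minus_nbrs_gt0 v : (0 < #|minus_nbrs v|)%N.
Proof.
rewrite lt0n; apply/negP => /eqP/cards0_eq N0.
have := maxA (val v |: A); rewrite cardsU1 (valP v) add1n ltnn => h; apply: notF; apply: h.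
have Gv x : x \in A -> G x (val v) = 1.
  move=> xA; have : Sub x xA \notin minus_nbrs v by rewrite N0 inE.
  have xv : x != val v := valIV (Sub x xA) v.
  by rewrite inE /=; case: (Goff x (val v) xv) => -> //; rewrite eqxx.
move=> x y; rewrite !inE => /predU1P[->|xA] /predU1P[->|yA]; rewrite ?eqxx // => xy.
- by rewrite GC Gv.
- exact: Gv.
exact: cliqueA.
Qed.

(** Multiplicity 1 would mean a common single minus-neighbour [i] and inner product 1; exchanging
    [i] for [v] and [w] would enlarge the maximum clique. *)
Lemma minus_nbrs_pair v w : #|minus_nbrs v| = 1%N -> #|minus_nbrs w| = 1%N ->
  meet_mult V I minus_nbrs minus_rel v w <> 1%N.
Proof.
move=> v1 w1 vw1; have := meet_mult_eq1 _ _ _ _ _ _ vw1 => /eqP/cards1P[i Ei].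
have vw : v != w by apply/eqP => vw; rewrite vw meet_multxx in vw1.
have Gvw : G (val v) (val w) = 1.
  have vw' : val v != val w by rewrite (inj_eq val_inj).
  case: (Goff _ _ vw') => // Gm; move: vw1; rewrite /meet_mult (negbTE vw) Ei cards1.
  by rewrite /minus_rel vw Gm eqxx.
have NE u : #|minus_nbrs u| = 1%N -> i \in minus_nbrs u -> minus_nbrs u = [set i].
  by move=> u1 iu; apply/esym/eqP; rewrite eqEcard sub1set iu u1 cards1.
have : i \in minus_nbrs v :&: minus_nbrs w by rewrite Ei set11.
rewrite inE => /andP[/(NE v v1) Nv /(NE w w1) Nw].
have G1 u x : minus_nbrs u = [set i] -> x \in A -> x != val i -> G x (val u) = 1.
  move=> Nu xA xi; have : Sub x xA \notin minus_nbrs u by rewrite Nu inE -(inj_eq val_inj).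
  have xu : x != val u := valIV (Sub x xA) u.
  by rewrite inE /=; case: (Goff x (val u) xu) => -> //; rewrite eqxx.
have := maxA (val v |: (val w |: (A :\ val i))).
have vwA : val v \notin val w |: (A :\ val i).
  by rewrite !inE (inj_eq val_inj) (negbTE vw) (negbTE (valP v)) andbF.
have wA : val w \notin A :\ val i by rewrite !inE (negbTE (valP w)) andbF.
rewrite !cardsU1 vwA wA (cardsD1 (val i) A) (valP i) !add1n ltnn => h; apply: notF; apply: h.
move=> x y; rewrite !inE => /or3P[/eqP->|/eqP->|/andP[xi xA]] /or3P[/eqP->|/eqP->|/andP[yi yA]];
  rewrite ?eqxx // => xy.
- by rewrite GC G1.
- by rewrite GC.
- by rewrite GC G1.
- exact: G1.
- exact: G1.
exact: cliqueA.
Qed.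

Lemma gram_kernel_bound_of_max_clique : (277 <= #|T|)%N ->
  exists P : {set T}, (3 * #|P| + 3 <= #|T|)%N /\
   forall f : T -> R, (forall x, \sum_y G x y * f y = 0) ->
     (forall x, x \in P -> f x = 0) -> forall x, f x = 0.
Proof.
rewrite -card_clique_split => n277.
have eI : irreflexive minus_rel by move=> v; rewrite /minus_rel eqxx.
have eC : symmetric minus_rel by move=> v w; rewrite /minus_rel eq_sym GC.
have psd' u z : 0 <= \sum_i u i * clique_row R V I minus_nbrs u z i +
    \sum_v z v * outer_row R V I minus_nbrs minus_rel u z v.
  have := psd (combine u z); rewrite sum_clique_split.
  have eu : (fun j => combine u z (val j)) = u by apply/funext => j; exact: combine_clique.
  have ez : (fun v => combine u z (val v)) = z by apply/funext => v; exact: combine_outer.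
  under eq_bigr do rewrite combine_clique clique_rowE eu ez.
  by under [X in _ + X]eq_bigr do rewrite combine_outer outer_rowE eu ez.
have N_half v : (2 * #|minus_nbrs v| <= #|{: I}|)%N.
  by rewrite minus_nbrsE card_clique_type halfA // (valP v).
have I49 : (49 <= #|{: I}|)%N by rewrite card_clique_type.
have [P [cP hP]] := gram_kernel_bound R V I minus_nbrs minus_rel eI eC psd'
  minus_nbrs_gt0 N_half minus_nbrs_pair I49 n277.
exists (val @: P); rewrite card_imset; last exact: val_inj.
split=> // f kf fP.
have [u0 z0] := hP (fun i => f (val i)) (fun v => f (val v))
  (fun i => etrans (esym (clique_rowE f i)) (kf (val i)))
  (fun v => etrans (esym (outer_rowE f v)) (kf (val v)))
  (fun v vP => fP (val v) (imset_f _ vP)).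
move=> x; case: (boolP (x \in A)) => xA.
  exact: (u0 (Sub x xA)).
exact: (z0 (Sub x xA)).
Qed.

End GramMatrix.

(** * Least eigenvalue and switching classes *)

From mathcomp Require Import complex.

Section LeastEigenvalue.
Local Open Scope sesquilinear_scope.
Local Notation toC := (real_complex _).

(** Over the complex numbers [S] is Hermitian. In an orthonormal eigenbasis both forms are diagonal,
    and each diagonal entry is real and an eigenvalue of [S], as the characteristic polynomial
    shows. *)
Lemma quadratic_form_ge (R : rcfType) (n : nat) (S : 'M[R]_n) (a : R) (v : 'rV[R]_n) :
  S^T = S -> (forall b, eigenvalue S b -> a <= b) ->
  a * (v *m v^T) 0 0 <= (v *m S *m v^T) 0 0.
Proof.
move=> Ssym Sa.
pose A := map_mx toC S.
have conjA m p (M : 'M[R]_(m, p)) : map_mx Num.conj (map_mx toC M) = map_mx toC M.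
  by apply/matrixP => i j; rewrite !mxE; apply/CrealP/complex_realP; exists (M i j).
have Aherm : A \is hermsymmx.
  apply/is_hermitianmxP; rewrite expr0 scale1r.
  apply/matrixP => i j; rewrite /A -[in LHS]Ssym !mxE.
  by apply/esym/CrealP/complex_realP; exists (S j i).
pose P := spectralmx A; pose D := spectral_diag A.
have AE : A = invmx P *m diag_mx D *m P.
  exact/orthomx_spectralP/hermitian_normalmx.
have Preal := hermitian_spectral_diag_real Aherm.
have Punit : P \in unitmx := spectral_unit A.
have Dge i : toC a <= D 0 i.
  have Dr : D 0 i \is Num.real by apply/mxOverP.
  rewrite -(RRe_real Dr) lecR; apply: Sa.
  rewrite eigenvalue_root_char -(fmorph_root toC) map_char_poly /= RRe_real //.
  rewrite -eigenvalue_root_char; apply/eigenvalueP; exists (row i P).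
    rewrite -[map_mx _ S]/A AE !mulmxA -!row_mul mulmxV // mul1mx.
    by rewrite row_mul row_diag_mx -scalemxAl -rowE.
  apply/eqP => /(congr1 (mulmx^~ (invmx P))); rewrite -row_mul mulmxV // mul0mx.
  by move/rowP/(_ i); rewrite !mxE eqxx => /eqP; rewrite oner_eq0.
pose w := map_mx toC v *m invmx P.
have wE : P *m map_mx toC v^T = w ^t*.
  rewrite /w trmx_mul map_mxM /= invmx_unitary ?spectral_unitarymx // trmxCK.
  by rewrite map_trmx conjA.
have vv : toC ((v *m v^T) 0 0) = (w *m w ^t*) 0 0.
  by rewrite -wE mulmxA mulmxKV // -map_mxM [RHS]mxE.
have vSv : toC ((v *m S *m v^T) 0 0) = (w *m diag_mx D *m w ^t*) 0 0.
  rewrite -wE /w; transitivity ((map_mx toC v *m A *m map_mx toC v^T) 0 0).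
    by rewrite -!map_mxM [RHS]mxE.
  by rewrite AE !mulmxA.
rewrite -lecR rmorphM /= vv vSv !mxE mulr_sumr; apply: ler_sum => i _.
rewrite mul_mx_diag !mxE mulrAC [leRHS]mulrC; apply: ler_wpM2r; last exact: Dge.
by rewrite -normCK exprn_ge0.
Qed.

End LeastEigenvalue.

(** The matrix [E] selects the coordinates in [P]; it is injective on the kernel, whose dimension is
    therefore at most [#|P|]. *)
Lemma rank_ge_of_kernel_bound (F : fieldType) (n : nat) (H : 'M[F]_n) (P : {set 'I_n}) :
  (forall v : 'rV[F]_n, v *m H = 0 -> (forall i, i \in P -> v 0 i = 0) -> v = 0) ->
  (n <= \rank H + #|P|)%N.
Proof.
move=> hP.
pose E : 'M[F]_(n, #|P|) := \matrix_(i, j) (i == enum_val j)%:R.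
have rk : \rank (kermx H *m E) = \rank (kermx H).
  apply/mxrank_injP/eqP/row_matrixP => i; rewrite row0; apply: hP.
    apply/sub_kermxP; apply: submx_trans (row_sub _ _) _; exact: capmxSl.
  move=> j jP; have : row i (kermx H :&: kermx E)%MS *m E = 0.
    apply/sub_kermxP; apply: submx_trans (row_sub _ _) _; exact: capmxSr.
  move/rowP/(_ (enum_rank_in jP j)); rewrite !mxE (bigD1 j) //= !mxE enum_rankK_in // eqxx mulr1.
  rewrite big1 ?addr0 // => m mj; rewrite !mxE enum_rankK_in // (negbTE mj).
  by rewrite mulr0.
have := rank_leq_col (kermx H *m E); rewrite rk mxrank_ker.
by rewrite leq_subLR.
Qed.

(** * Signed indices and the switching graph *)

Section Switching.
Variables (R : realType) (n : nat) (S : 'M[R]_n).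
Hypothesis seidelS : is_seidel S.

(** The index [i] taken with the sign [(-1) ^+ a]; distinct signed indices are then compared through
    the signed entries of [S]. *)
Definition copy (a : bool) (i : 'I_n) : 'I_(n + n) := if a then rshift n i else lshift n i.

Lemma copy_inj a i b j : copy a i = copy b j -> a = b /\ i = j.
Proof.
case: a; case: b => /=; first by move/rshift_inj->.
- by move/eqP; rewrite eq_rlshift.
- by move/eqP; rewrite eq_lrshift.
by move/lshift_inj->.
Qed.

Lemma copyP (x : 'I_(n + n)) : exists a i, x = copy a i.
Proof.
by case: (split_ordP x) => i ->; [exists false, i|exists true, i].
Qed.

Lemma seidel_sym i j : S i j = S j i.
Proof. by case: seidelS => Ss _ _; rewrite -{1}Ss mxE. Qed.

Lemma switching_mx_diag a i : switching_mx S (copy a i) (copy a i) = 0.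
Proof.
case: seidelS => _ Sd _.
by case: a; rewrite /switching_mx /= ?block_mxEul ?block_mxEdr Sd.
Qed.

Lemma switching_mx_off a b i j : i != j ->
  switching_mx S (copy a i) (copy b j) = (-1) ^+ a * (-1) ^+ b * S i j.
Proof.
move=> /negbTE ij; case: a; case: b; rewrite /switching_mx /=
  ?block_mxEul ?block_mxEur ?block_mxEdl ?block_mxEdr ?mxE ?ij /=; ring.
Qed.

Lemma independent_card_le (Y : {set 'I_(n + n)}) :
  independent (switching_graph S) Y -> (#|Y| <= alpha_class S)%N.
Proof. move=> iY; exact: leq_bigmax_cond iY. Qed.

Lemma independentP (Y : {set 'I_(n + n)}) :
  (forall x y, x \in Y -> y \in Y -> switching_mx S x y != -1) <->
  independent (switching_graph S) Y.
Proof.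
split=> [h|/forall_inP h x y xY yY].
  by apply/forall_inP => x xY; apply/forall_inP => y yY; exact: h.
by have /forall_inP := h x xY; exact.
Qed.

Lemma maximum_independent : exists X : {set 'I_(n + n)},
  independent (switching_graph S) X /\ #|X| = alpha_class S.
Proof.
have i0 : (0 < #|[pred X | independent (switching_graph S) X]|)%N.
  apply/card_gt0P; exists set0; rewrite inE; apply/independentP => x y.
  by rewrite inE.
have [X iX eX] := eq_bigmax_cond (fun X : {set _} => #|X|) i0.
by exists X; split.
Qed.

Lemma seidel_signed_eq1 a b i j : i != j ->
  switching_mx S (copy a i) (copy b j) != -1 -> (-1) ^+ a * (-1) ^+ b * S i j = 1.
Proof.
move=> ij; rewrite switching_mx_off //; case: seidelS => _ _ /(_ i j ij).
by case: a; case: b => -[->|->]; rewrite ?expr0 ?expr1 ?mulr1 ?mul1r ?mulrN1 ?opprK ?eqxx.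
Qed.

(* The signs [s] are those of a maximum signed clique, extended outside it by
   the majority rule. *)
Lemma normalized_signs : (49 <= alpha_class S)%N ->
  exists (s : 'I_n -> bool) (A : {set 'I_n})
    (G := fun i j => (-1) ^+ s i * (-1) ^+ s j * (S + 5%:M) i j),
  [/\ (49 <= #|A|)%N, gram_clique R _ G A,
      forall D, gram_clique R _ G D -> (#|D| <= #|A|)%N &
      forall x, x \notin A -> (2 * #|[set i in A | G i x == -1%R]| <= #|A|)%N].
Proof.
move=> a49; have [X [/independentP iX cX]] := maximum_independent.
have X49 : (49 <= #|X|)%N by rewrite cX.
pose s0 i := copy true i \in X.
pose A := [set i | (copy false i \in X) || (copy true i \in X)].
(* The two copies of one index are not adjacent, so a third vertex over some [j] is needed: it would
   force both [S i j] and [- S i j] to have the same sign. *)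
have notboth i : copy false i \in X -> copy true i \in X -> False.
  move=> fX tX.
  have [x xX xn] : exists2 x, x \in X & x \notin [set copy false i; copy true i].
    apply/subsetPn; apply: contraTN X49 => /subset_leq_card; rewrite -ltnNge => h.
    by apply: leq_trans (_ : 3 <= 49)%N => //; rewrite ltnS (leq_trans h) // cards2; case: (_ != _).
  have [c [j ex]] := copyP x.
  have ij : i != j.
    by apply: contraNneq xn => ij; rewrite ex -ij !inE; case: (c); rewrite eqxx ?orbT.
  have := seidel_signed_eq1 false c i j ij; rewrite -ex iX // => /(_ isT).
  have := seidel_signed_eq1 true c i j ij; rewrite -ex iX // => /(_ isT).
  rewrite expr0 expr1; lra.
have s0X i : i \in A -> copy (s0 i) i \in X.
  by rewrite inE /s0; case: (boolP (copy true i \in X)) => // _; rewrite orbF.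
have XA : (#|X| <= #|A|)%N.
  apply: leq_trans (leq_imset_card (fun i => copy (s0 i) i) (mem A)).
  apply: subset_leq_card; apply/subsetP => x xX.
  have [c [i ex]] := copyP x.
  rewrite ex in xX *; apply/imsetP; exists i.
    by rewrite inE; case: c xX {ex} => ->; rewrite ?orbT.
  congr copy; rewrite /s0; case: c xX {ex} => [-> //|fX].
  by apply/esym/negP; exact: notboth.
move: A s0X XA => A s0X XA.
pose maj x := [set i in A | (-1) ^+ s0 i * (S + 5%:M) i x == -1].
pose s x := if x \in A then s0 x else (#|A| < 2 * #|maj x|)%N.
exists s, A => G.
have Goff i j : i != j -> G i j = (-1) ^+ s i * (-1) ^+ s j * S i j.
  by move=> /negbTE ij; rewrite /G !mxE ij mulr0n addr0.
split.
- exact: leq_trans XA.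
- move=> i j iA jA ij; rewrite Goff // /s iA jA.
  by apply: seidel_signed_eq1 => //; apply: iX; exact: s0X.
(* A clique for the signs [s] lifts to an independent set of signed copies, so [alpha_class S]
   bounds it. *)
- move=> D cD; apply: leq_trans XA; rewrite cX.
  have inj : injective (fun i => copy (s i) i) by move=> i j /copy_inj[].
  rewrite -(card_imset (mem D) inj).
  apply: independent_card_le; apply/independentP => _ _ /imsetP[i iD ->] /imsetP[j jD ->].
  have [<-|ij] := eqVneq i j.
    by rewrite switching_mx_diag eq_sym oppr_eq0 oner_eq0.
  rewrite switching_mx_off // -Goff // cD //.
  by rewrite -subr_eq0 opprK -[1 + 1]/(2%:R) pnatr_eq0.
move=> x xA.
have Gx i : i \in A -> G i x = (-1) ^+ s x * ((-1) ^+ s0 i * (S + 5%:M) i x).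
  move=> iA; have si : s i = s0 i by rewrite /s iA.
  by rewrite /G si (mulrC (_ ^+ s0 i)) -mulrA.
have sx : s x = (#|A| < 2 * #|maj x|)%N by rewrite /s (negbTE xA).
have [lt|le] := ltnP #|A| (2 * #|maj x|)%N.
  (* Switching [x] exchanges the entries 1 and -1 over [A], leaving the minority. *)
  have -> : [set i in A | G i x == -1] = A :\: maj x.
    apply/setP => i; rewrite !inE; case: (boolP (i \in A)) => iA; rewrite ?andbF ?andbT //=.
    rewrite Gx // sx lt expr1 mulN1r eqr_opp.
    have ix : i != x by apply: contraNneq xA => <-.
    have -> : (S + 5%:M) i x = S i x by rewrite !mxE (negbTE ix) mulr0n addr0.
    have n1 : (1 == -1 :> R) = false by rewrite -subr_eq0 opprK -[1 + 1]/(2%:R) pnatr_eq0.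
    have n2 : (-1 == 1 :> R) = false by rewrite eq_sym.
    by case: seidelS => _ _ /(_ i x ix) [] ->; case: (s0 i);
      rewrite ?expr0 ?expr1 ?mul1r ?mulrN1 ?mulr1 ?opprK ?eqxx ?n1 ?n2.
  have := cardsID (maj x) A.
  have -> : A :&: maj x = maj x by apply/setIidPr/subsetP => i; rewrite inE => /andP[].
  by move: lt; move: #|maj x| #|A| #|_ :\: _|; lia.
suff -> : [set i in A | G i x == -1] = maj x by [].
apply/setP => i; rewrite !inE; case: (boolP (i \in A)) => //= iA.
by rewrite Gx // sx ltnNge le /= expr0 mul1r.
Qed.

End Switching.

Theorem theorem5p4 (R : realType) (n : nat) (S : 'M[R]_n)
    (seidelS : is_seidel S)
    (n_ge277 : (277 <= n)%N)
    (lambda_min : is_min_eigenvalue S (-5))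
    (alpha_ge49 : (49 <= alpha_class S)%N) :
  2 * n%:R / 3 + 1 <= (\rank (S + 5%:M)%R)%:R :> R.
Proof.
have [Ssym Sdiag Soff] := seidelS; have [_ Smin] := lambda_min.
have [s [A]] := normalized_signs R n S seidelS alpha_ge49.
set H := S + 5%:M; set G := fun i j => _; case=> cA cliqueA maxA halfA.
have HC i j : H i j = H j i by rewrite !mxE (seidel_sym _ _ _ seidelS) eq_sym.
have eps2 i : (-1) ^+ s i * (-1) ^+ s i = 1 :> R by rewrite -expr2 sqrr_sign.
have GC i j : G i j = G j i by rewrite /G HC (mulrC (_ ^+ s i)).
have Gdiag i : G i i = 5 by rewrite /G eps2 mul1r !mxE Sdiag eqxx add0r.
have Goff i j : i != j -> G i j = 1 \/ G i j = -1.
  move=> ij; rewrite /G !mxE (negbTE ij) mulr0n addr0 -signr_addb.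
  by case: (Soff i j ij) => ->; case: (_ (+) _);
    rewrite ?expr0 ?expr1 ?mulN1r ?mul1r ?opprK; auto.
have Hpsd (v : 'rV[R]_n) : 0 <= (v *m H *m v^T) 0 0.
  have := quadratic_form_ge R n S (-5) v Ssym Smin.
  have -> : (v *m H *m v^T) 0 0 = (v *m S *m v^T) 0 0 + 5 * (v *m v^T) 0 0.
    rewrite /H mulmxDr mulmxDl mul_mx_scalar -scalemxAl [LHS]mxE.
    by congr (_ + _); rewrite [LHS]mxE.
  by lra.
have psd f : 0 <= \sum_x f x * \sum_y G x y * f y.
  (* Absorbing the signs into the vector turns the form of [G] into that of [H]. *)
  pose v : 'rV[R]_n := \row_i ((-1) ^+ s i * f i).
  suff -> : \sum_x f x * \sum_y G x y * f y = (v *m H *m v^T) 0 0 by [].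
  rewrite mxE; apply: eq_bigr => x _; rewrite [(v *m H) _ _]mxE [v^T _ _]mxE.
  rewrite mulr_sumr mulr_suml; apply: eq_bigr => y _; rewrite ![v _ _]mxE (HC y x) /G.
  by move: (H x y) => h; ring.
have n277 : (277 <= #|'I_n|)%N by rewrite card_ord.
have [P [cP hP]] := gram_kernel_bound_of_max_clique R _ G A GC Gdiag Goff psd
  cliqueA maxA cA halfA n277.
rewrite card_ord in cP.
have rk : (n <= \rank H + #|P|)%N.
  apply: rank_ge_of_kernel_bound => v vH vP; apply/rowP => i; rewrite [RHS]mxE.
  have : (-1) ^+ s i * v 0 i = 0.
    apply: (hP (fun i => (-1) ^+ s i * v 0 i)) => [x|x /vP ->]; last by rewrite mulr0.
    transitivity ((-1) ^+ s x * (v *m H) 0 x); last by rewrite vH mxE mulr0.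
    rewrite [(v *m H) _ _]mxE mulr_sumr; apply: eq_bigr => y _.
    rewrite /G (HC y x); transitivity ((-1) ^+ s y * (-1) ^+ s y * ((-1) ^+ s x * (v 0 y * H x y))).
      by move: (H x y) => h; ring.
    by rewrite eps2 mul1r.
  by move/eqP; rewrite mulf_eq0 signr_eq0 => /eqP.
(* Combine [n <= \rank H + #|P|] with [3 * #|P| + 3 <= n]. *)
have : (2 * n + 3 <= 3 * \rank H)%N by lia.
by rewrite -(ler_nat R) natrD !natrM; lra.
Qed.
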